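(* Let $p>n\ge2$ and let $r,s_1,\dots,s_{n-1}$ be positive integers with $s_1<s_2<\cdots<s_{n-1}$ such that $p^{s_i+r}$ is a power of $q$ for all $i=1,\dots,n-1$. Put $$F:=\sum_{j=0}^{n-1}X_{n-j}^{p^r}X_1^{j},$$ and let $S_n$ be the affine hypersurface (in affine coordinates $X_1,\dots,X_n$) given by $$ \left| \begin{array}{ccccccc} 1 & X_1^{p^{s_{n-1}+r}} & X_1^{2p^{s_{n-1}+r}} & \cdots & X_1^{(n-2)p^{s_{n-1}+r}} & X_1^{(n-1)p^{s_{n-1}+r}} & F^{p^{s_{n-1}+r}}\\ \vdots & \vdots & \vdots & & \vdots & \vdots & \vdots\\ 1 & X_1^{p^{s_{1}+r}} & X_1^{2p^{s_{1}+r}} & \cdots & X_1^{(n-2)p^{s_{1}+r}} & X_1^{(n-1)p^{s_{1}+r}} & F^{p^{s_{1}+r}}\\ 1 & X_1 & X_1^{2} & \cdots & X_1^{n-2} & X_1^{n-1} & F\\ 0 & 0 & 0 & \cdots & 0 & 1 & X_1^{p^{r}} \end{array} \right| =0 $$ (an $(n+1)\times(n+1)$ determinant: one row for each of $s_{n-1},\dots,s_1$, followed by the two last rows displayed). Let $\overline{S_n}\subset\mathbb P^n(\overline{\mathbb F}_q)$ be its projective closure. Assume that $\mathcal X\subset\mathbb P^n(\overline{\mathbb F}_q)$ is a nondegenerate curve defined over $\mathbb F_q$ by the coordinate functions $1,x_1,\dots,x_n$, where $x_1$ is a separating element of $\mathbb F_q(\mathcal X)$, such that $\mathcal X$ is contained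 in a nonlinear component of $\overline{S_n}$. Then $\mathcal X$ has order sequence $(0,1,p^{s_1},p^{s_2},\dots,p^{s_{n-1}})$, and if $n>2$, the last term of the $\mathbb F_{p^{s_{n-1}-s_j}}$-Frobenius order sequence of $\mathcal X$ equals $p^{s_{n-1}}$ for $j=1,\dots,n-2$.
   Context: $q$ is a power of a prime $p$ and $\overline{\mathbb F}_q$ is an algebraic closure of $\mathbb F_q$. A curve $\mathcal X\subset\mathbb P^n(\overline{\mathbb F}_q)$ is a projective, geometrically irreducible algebraic curve; it is nondegenerate if it is not contained in a hyperplane. If $X_0,\dots,X_n$ are projective coordinates, the coordinate functions of $\mathcal X$ are the images $x_i$ of $X_i/X_0$ in the function field $\mathbb F_q(\mathcal X)$ (so $x_0=1$). A separating element $\zeta$ is a function such that the function field is finite separable over the rational function field generated by $\zeta$; $D_\zeta^{(k)}$ is the $k$-th Hasse derivative with respect to $\zeta$. Order sequence: for a nonsingular point $P$, the intersection multiplicities of $\mathcal X$ at $P$ with hyperplanes take exactly $n+1$ values; the increasing sequence of these values is the same, $(\varepsilon_0,\dots,\varepsilon_n)$, for all but finitely many $P$, and is called the order sequence of $\mathcal X$. Frobenius order sequence: for a nondegenerate curve over $\mathbb F_Q$ with coordinate functions $x_0,\dots,x_n$, the $\mathbb F_Q$-Frobenius order sequence is the lexicographically minimal sequence $\nu_0<\cdots<\nu_{n-1}$ of non-negative integers such that the $(n+1)\times(n+1)$ determinant with first row $(x_0^Q,\dots,x_n^Q)$ and subsequent rows $(D_\zeta^{(\nu_i)}x_0,\dots,D_\zeta^{(\nu_i)}x_n)$,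 $i=0,\dots,n-1$, is nonzero. A curve over $\mathbb F_q$ is regarded over $\mathbb F_{q^m}$ when speaking of its $\mathbb F_{q^m}$-Frobenius order sequence; note that each $p^{s_{n-1}-s_j}=p^{s_{n-1}+r}/p^{s_j+r}$ is a power of $q$. *)

(* Defs.v *)
From HB Require Import structures.
From mathcomp Require Import all_boot all_order all_algebra.
From mathcomp Require Import closed_field separable mpoly.

Set Implicit Arguments.
Unset Strict Implicit.
Unset Printing Implicit Defensive.

Import Order.TTheory GRing.Theory.
Local Open Scope ring_scope.

(* A point of P^n(L) is given by any nonzero vector of homogeneous coordinates,
   so a subset of P^n(L) is a scaling-invariant predicate on nonzero vectors. *)

Definition pset (L : fieldType) (n : nat) := 'rV[L]_n.+1 -> Prop.

Definition psubset (L : fieldType) (n : nat) (X Y : pset L n) : Prop :=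
  forall P, X P -> Y P.

Definition same_point (L : fieldType) (n : nat) (P Q : 'rV[L]_n.+1) : Prop :=
  exists2 c : L, c != 0 & P = c *: Q.

Definition pzeros (L : fieldType) (n : nat) (I : {mpoly L[n.+1]} -> Prop) :
    pset L n :=
  fun P => P != 0 /\ forall f, I f -> f.@[P ord0] = 0.

(* The subfield of order Q of an algebraic closure of a finite field, Q being
   a power of the order of that finite field. *)
Definition subFq (L : fieldType) (Q : nat) : pred L := fun a => a ^+ Q == a.

Definition homogeneous (L : fieldType) (n : nat) (f : {mpoly L[n]}) : Prop :=
  exists d : nat, f \is d.-homog.

Definition closed_pset (L : fieldType) (n : nat) (X : pset L n) : Prop :=
  exists2 I : {mpoly L[n.+1]} -> Prop,
    (forall f, I f -> homogeneous f) & (forall P, X P <-> pzeros I P).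

Definition closed_pset_over (L : fieldType) (n : nat) (Q : nat) (X : pset L n)
    : Prop :=
  exists2 I : {mpoly L[n.+1]} -> Prop,
    (forall f, I f -> homogeneous f /\ f \is a mpolyOver n.+1 (subFq Q)) &
    (forall P, X P <-> pzeros I P).

Definition irreducible_pset (L : fieldType) (n : nat) (X : pset L n) : Prop :=
  [/\ closed_pset X, exists P, X P &
    forall Y Z : pset L n, closed_pset Y -> closed_pset Z ->
      (forall P, X P -> Y P \/ Z P) -> psubset X Y \/ psubset X Z].

Definition pdim_ge (L : fieldType) (n : nat) (d : nat) (X : pset L n) : Prop :=
  exists Z : nat -> pset L n,
    [/\ forall i, (i <= d)%N -> irreducible_pset (Z i),
        forall i, (i < d)%N ->
          psubset (Z i) (Z i.+1) /\ ~ psubset (Z i.+1) (Z i) &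
        psubset (Z d) X].

(* With L algebraically closed, irreducibility over L is the geometric one. *)
Definition curve_over (L : closedFieldType) (n : nat) (Q : nat) (X : pset L n)
    : Prop :=
  [/\ closed_pset_over Q X, irreducible_pset X, pdim_ge 1 X & ~ pdim_ge 2 X].

Definition hyperplane (L : fieldType) (n : nat) (a : 'rV[L]_n.+1) : pset L n :=
  fun P => P != 0 /\ \sum_i a ord0 i * P ord0 i = 0.

Definition nondegenerate_pset (L : fieldType) (n : nat) (X : pset L n) : Prop :=
  forall a : 'rV[L]_n.+1, a != 0 -> ~ psubset X (hyperplane a).

Definition linear_pset (L : fieldType) (n : nat) (X : pset L n) : Prop :=
  exists A : 'M[L]_n.+1, forall P, X P <-> P != 0 /\ P *m A = 0.

Definition pclosure (L : fieldType) (n : nat) (X : pset L n) : pset L n :=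
  pzeros (fun f => homogeneous f /\ forall P, X P -> f.@[P ord0] = 0).

Definition irreducible_component (L : fieldType) (n : nat) (C X : pset L n)
    : Prop :=
  [/\ irreducible_pset C, psubset C X &
    forall Z, irreducible_pset Z -> psubset Z X -> psubset C Z -> psubset Z C].

(* [K], equipped with [kappa : L -> K] and [x_0 = 1, x_1, ..., x_n], is the
   function field L(X) of X in P^n(L), with x_i the image of X_i / X_0. These
   properties determine (K, kappa, x) up to a unique isomorphism. *)

Definition function_field (L : fieldType) (n : nat) (X : pset L n)
    (K : fieldType) (kappa : {rmorphism L -> K}) (x : 'I_n.+1 -> K) : Prop :=
  [/\ x ord0 = 1,
      forall f : {mpoly L[n.+1]}, homogeneous f ->
        (mmap kappa x f = 0 <-> forall P, X P -> f.@[P ord0] = 0) &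
      forall y : K, exists (d : nat) (f g : {mpoly L[n.+1]}),
        [/\ f \is d.-homog, g \is d.-homog, mmap kappa x g != 0 &
            y = mmap kappa x f / mmap kappa x g]].

(* F_Q(X), seen inside L(X). *)
Definition in_function_field_over (L : fieldType) (n : nat) (Q : nat)
    (K : fieldType) (kappa : {rmorphism L -> K}) (x : 'I_n.+1 -> K) (y : K)
    : Prop :=
  exists (d : nat) (f g : {mpoly L[n.+1]}),
    [/\ f \is d.-homog /\ f \is a mpolyOver n.+1 (subFq Q),
        g \is d.-homog /\ g \is a mpolyOver n.+1 (subFq Q),
        mmap kappa x g != 0 &
        y = mmap kappa x f / mmap kappa x g].

(* F_Q(zeta), seen inside L(X). *)
Definition in_simple_extension (L : fieldType) (Q : nat) (K : fieldType)
    (kappa : {rmorphism L -> K}) (zeta y : K) : Prop :=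
  exists a b : {poly L},
    [/\ a \is a polyOver (subFq Q), b \is a polyOver (subFq Q),
        (map_poly kappa b).[zeta] != 0 &
        y = (map_poly kappa a).[zeta] / (map_poly kappa b).[zeta]].

Definition separating (L : fieldType) (n : nat) (Q : nat) (K : fieldType)
    (kappa : {rmorphism L -> K}) (x : 'I_n.+1 -> K) (zeta : K) : Prop :=
  [/\ in_function_field_over Q kappa x zeta,
      ~ algebraicOver kappa zeta,
      exists m (b : 'I_m -> K),
        (forall i, in_function_field_over Q kappa x (b i)) /\
        forall y, in_function_field_over Q kappa x y ->
          exists2 c : 'I_m -> K,
            (forall i, in_simple_extension Q kappa zeta (c i)) &
            y = \sum_i c i * b i &
      forall y, in_function_field_over Q kappa x y ->
        exists f : {poly K},
          [/\ forall i, in_simple_extension Q kappa zeta f`_i,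
              separable_poly f & root f y]].

(* D is the sequence of Hasse derivatives with respect to zeta: for a
   separating zeta there is exactly one such D, and D k zeta^m is
   'C(m, k) zeta^(m-k). It is given on L(X), and its restriction to F_Q(X) is
   the sequence of Hasse derivatives of F_Q(X). *)
Definition hasse_derivatives (L : fieldType) (K : fieldType)
    (kappa : {rmorphism L -> K}) (zeta : K) (D : nat -> K -> K) : Prop :=
  [/\ forall f, D 0%N f = f,
      forall k f g, D k (f + g) = D k f + D k g,
      forall k f g, D k (f * g) = \sum_(i < k.+1) D i f * D (k - i)%N g,
      forall k c, D k.+1 (kappa c) = 0 &
      forall k, D k.+1 zeta = (k == 0%N)%:R].

Definition in_local_ring (L : fieldType) (n : nat) (K : fieldType)
    (kappa : {rmorphism L -> K}) (x : 'I_n.+1 -> K) (P : 'rV[L]_n.+1) (y : K)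
    : Prop :=
  exists (d : nat) (f g : {mpoly L[n.+1]}),
    [/\ f \is d.-homog, g \is d.-homog, g.@[P ord0] != 0 &
        y = mmap kappa x f / mmap kappa x g].

Definition in_maximal_ideal (L : fieldType) (n : nat) (K : fieldType)
    (kappa : {rmorphism L -> K}) (x : 'I_n.+1 -> K) (P : 'rV[L]_n.+1) (y : K)
    : Prop :=
  exists (d : nat) (f g : {mpoly L[n.+1]}),
    [/\ f \is d.-homog, g \is d.-homog, f.@[P ord0] = 0, g.@[P ord0] != 0 &
        y = mmap kappa x f / mmap kappa x g].

Definition local_parameter (L : fieldType) (n : nat) (K : fieldType)
    (kappa : {rmorphism L -> K}) (x : 'I_n.+1 -> K) (P : 'rV[L]_n.+1) (t : K)
    : Prop :=
  in_maximal_ideal kappa x P t /\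
  forall y, in_maximal_ideal kappa x P y ->
    exists2 z, in_local_ring kappa x P z & y = z * t.

(* For P on a curve the local ring has dimension one: it is regular iff its
   maximal ideal is principal. *)
Definition nonsingular_point (L : fieldType) (n : nat) (K : fieldType)
    (kappa : {rmorphism L -> K}) (x : 'I_n.+1 -> K) (P : 'rV[L]_n.+1) : Prop :=
  exists t, local_parameter kappa x P t.

(* At a nonsingular point P the multiplicity is the valuation of the local
   equation (sum_i a_i x_i) / (sum_i b_i x_i), where sum_i b_i P_i <> 0. *)
Definition hyperplane_multiplicity (L : fieldType) (n : nat) (K : fieldType)
    (kappa : {rmorphism L -> K}) (x : 'I_n.+1 -> K) (P a : 'rV[L]_n.+1)
    (k : nat) : Prop :=
  exists (b : 'rV[L]_n.+1) (t u : K),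
    [/\ \sum_i b ord0 i * P ord0 i != 0,
        local_parameter kappa x P t,
        in_local_ring kappa x P u,
        ~ in_maximal_ideal kappa x P u &
        (\sum_i kappa (a ord0 i) * x i) / (\sum_i kappa (b ord0 i) * x i)
          = t ^+ k * u].

Definition order_sequence (L : fieldType) (n : nat) (X : pset L n)
    (K : fieldType) (kappa : {rmorphism L -> K}) (x : 'I_n.+1 -> K)
    (eps : seq nat) : Prop :=
  [/\ size eps = n.+1, sorted ltn eps &
    exists bad : seq 'rV[L]_n.+1,
    forall P, X P -> nonsingular_point kappa x P ->
      (forall Q, Q \in bad -> ~ same_point P Q) ->
      forall k, k \in eps <->
        exists2 a : 'rV[L]_n.+1,
          a != 0 & hyperplane_multiplicity kappa x P a k].

Definition frobenius_det (n : nat) (Q : nat) (K : fieldType)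
    (x : 'I_n.+1 -> K) (D : nat -> K -> K) (nu : n.-tuple nat) : K :=
  \det (col_mx (\row_(j < n.+1) x j ^+ Q)
               (\matrix_(i < n, j < n.+1) D (tnth nu i) (x j)) : 'M[K]_n.+1).

(* The sequence is known not to depend on zeta, hence the quantifier over all
   separating elements of F_Q(X). *)
Definition frobenius_order_sequence (L : fieldType) (n : nat) (Q : nat)
    (K : fieldType) (kappa : {rmorphism L -> K}) (x : 'I_n.+1 -> K)
    (nu : n.-tuple nat) : Prop :=
  sorted ltn nu /\
  forall (zeta : K) (D : nat -> K -> K),
    separating Q kappa x zeta -> hasse_derivatives kappa zeta D ->
    frobenius_det Q x D nu != 0 /\
    forall mu : n.-tuple nat,
      sorted ltn mu -> frobenius_det Q x D mu != 0 ->
      ((nu : n.-tuplelexi nat) <= (mu : n.-tuplelexi nat))%O.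

(* X i stands for the variable X_i; X 0 does not occur. *)
Definition polF (p n r : nat) (R : comNzRingType) (X : nat -> R) : R :=
  \sum_(0 <= j < n) X (n - j)%N ^+ (p ^ r) * X 1%N ^+ j.

(* The exponent E such that row i < n is
   (1, X_1^E, ..., X_1^((n-1) E), F^E). *)
Definition row_exponent (p n r : nat) (s : nat -> nat) (i : nat) : nat :=
  if (i < n.-1)%N then (p ^ (s (n.-1 - i) + r))%N else 1%N.

Definition mxS (p n r : nat) (s : nat -> nat) (R : comNzRingType)
    (X : nat -> R) : 'M[R]_n.+1 :=
  \matrix_(i < n.+1, k < n.+1)
    if (i < n)%N then
      if (k < n)%N then X 1%N ^+ (k * row_exponent p n r s i)
      else polF p n r X ^+ row_exponent p n r s i
    else if (k < n.-1)%N then 0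
    else if (k < n)%N then 1
    else X 1%N ^+ (p ^ r).

(* S_n as a subset of P^n(L), embedded by (X_1, ..., X_n) |->
   (1 : X_1 : ... : X_n). *)
Definition hypersurfaceS (p n r : nat) (s : nat -> nat) (L : fieldType) :
    pset L n :=
  fun P => P ord0 ord0 != 0 /\
    \det (mxS p n r s (fun i => P ord0 (inord i) / P ord0 ord0)) = 0.

(* Main.v *)
Require Import Defs.
From HB Require Import structures.
From mathcomp Require Import all_boot all_order all_algebra.
From mathcomp Require Import closed_field separable mpoly.
From mathcomp Require Import finfield polyXY.
From mathcomp Require Import boolp.
From mathcomp Require Import perm zify ring.
Set Implicit Arguments.
Unset Strict Implicit.
Unset Printing Implicit Defensive.
Import Order.TTheory GRing.Theory.
Local Open Scope ring_scope.

(** Write [z = x_1], [f = F(x_1, ..., x_n)], [gamma_0 = - f] and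
    [gamma_j = z ^ (n - j)] for [1 <= j <= n], so that
    [sum_(j > 0) x_j ^ (p ^ r) gamma_j = f].

    A vector in the kernel of the matrix of [S_n] is a polynomial [V] of degree
    at most [n - 1] which takes the value [f ^ E] at [z ^ E] for every row
    exponent [E], and whose coefficient of degree [n - 1] is [z ^ (p ^ r)].  The
    [n - 1] rows with [E = p ^ (s_i + r)] already determine the other
    coefficients of [V], and show that they are [p ^ r]-th powers.  The row
    [E = 1] then compares two expansions of [f] in [1, z, ..., z ^ (n - 1)] with
    [p ^ r]-th powers as coefficients; as [z], having a nonzero derivative, is not
    a [p]-th power and [n < p], such an expansion is unique.  Taking [p ^ r]-th roots gives
    ([core_relation])

      [sum_j gamma_j ^ (p ^ s_i) x_j = 0]        for [0 < i < n].

    Everything else follows from these relations and from the fact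
    ([dgamma_relation_neq0]) that the functions
    [G_i = sum_j gamma'_j ^ (p ^ s_i) x_j], where [gamma'] is the derivative of
    [gamma] along [z], are not zero.  To see the latter, differentiate the
    relations: the polynomial [A(T) = sum_j x'_j T ^ (n - j)] has degree [n - 1]
    and vanishes at the [n - 1] distinct points [z ^ (p ^ s_i)], hence these are
    simple roots; but differentiating [G_i = 0] would give
    [A'(z ^ (p ^ s_i)) = 0].  This argument uses only a derivation at first
    order, possibly defined on a part of the field and with values in another
    field; [dual_values] axiomatizes this.  It is applied to jets of order one
    at a nonsingular point, and to the first Hasse derivative.

    Order sequence.  At a nonsingular point [P] which avoids the zeros and poles
    of finitely many functions, [z - z(P)] is a local parameter, and the
    hyperplane [sum_j gamma_j(P) ^ (p ^ s_i) X_j = 0] meets the curve with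
    multiplicity [p ^ s_i]: by the relations its equation equals
    [sum_j (gamma_j(P) - gamma_j) ^ (p ^ s_i) x_j], whose expansion in
    [z - z(P)] begins with the coefficient [- G_i(P)].  With [X_0 = 0] and
    [X_1 = x_1(P) X_0] this gives [n + 1] hyperplanes with distinct
    multiplicities; they form a basis, so no other
    multiplicity occurs ([hyperplane_ordersP]).  That a nonzero function has
    finitely many zeros and poles ([value_neq0_almost_all]) holds because any
    two functions on the curve are algebraically dependent.

    Frobenius order sequence.  For any separating [zeta], the vector
    [c_i = (gamma_j ^ (p ^ s_i))_j] annihilates the rows [D ^ (k) x] with
    [k < p ^ s_i], and its product with [D ^ (p ^ s_i) x] is
    [- (D ^ (1) z) ^ (p ^ s_i) G_i].  Let [e_i] be its product with the row
    [x ^ Q].  For [Q = p ^ (s_(n-1) - s_j)] the [Q]-th power of the [j]-th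
    relation says that [e_(n-1) = 0].  Let [I] be the least positive index such
    that [e_i = 0] for all [i >= I].  Then the Frobenius orders are the orders
    without the one of index [I]: after multiplication by the vectors [c_i] the
    determinant becomes triangular, and a smaller sequence would leave too large
    a block of zeros.  As [I < n], the last order survives.  The [e_i] do not
    involve [zeta], so the sequence does not depend on it. *)

(** * Frobenius powers, and polynomials with prescribed values *)

Section CharP.
Variables (p : nat) (R : comNzRingType) (charR : p \in [pchar R]).

Lemma expr0_pchar e : 0 ^+ (p ^ e) = 0 :> R.
Proof.
by rewrite expr0n gtn_eqF // expn_gt0 prime_gt0 // (pcharf_prime charR).
Qed.

Lemma exprD_pchar e (x y : R) : (x + y) ^+ (p ^ e) = x ^+ (p ^ e) + y ^+ (p ^ e).
Proof.
apply: exprDn_pchar; rewrite pnatX; apply/orP; left.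
by rewrite (eq_pnat _ (pcharf_eq charR)) pnat_id // (pcharf_prime charR).
Qed.

Lemma exprN_pchar e (x : R) : (- x) ^+ (p ^ e) = - (x ^+ (p ^ e)).
Proof.
by apply/eqP; rewrite -subr_eq0 opprK -exprD_pchar addNr expr0_pchar.
Qed.

Lemma exprB_pchar e (x y : R) : (x - y) ^+ (p ^ e) = x ^+ (p ^ e) - y ^+ (p ^ e).
Proof. by rewrite exprD_pchar exprN_pchar. Qed.

Lemma expr_sum_pchar e I (s : seq I) (P : pred I) (F : I -> R) :
  (\sum_(i <- s | P i) F i) ^+ (p ^ e) = \sum_(i <- s | P i) F i ^+ (p ^ e).
Proof.
apply: (big_morph (fun x => x ^+ (p ^ e))) => [x y|]; first exact: exprD_pchar.
exact: expr0_pchar.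
Qed.

Lemma pchar_natX e : (0 < e)%N -> (p ^ e)%:R = 0 :> R.
Proof. by case: e => // e _; rewrite natrX (pcharf0 charR) expr0n. Qed.

Lemma natr_expr_pchar e m : m%:R ^+ (p ^ e) = m%:R :> R.
Proof.
elim: e => [|e IHe]; first by rewrite expr1.
by rewrite expnSr exprM IHe; apply: (pFrobenius_aut_nat charR).
Qed.

Lemma natr_lt_pchar m : (0 < m < p)%N -> m%:R != 0 :> R.
Proof.
by case/andP=> m0 mp; rewrite -(dvdn_pcharf charR) gtnNdvd.
Qed.

End CharP.

Lemma expr_pchar_inj p (K : fieldType) (charK : p \in [pchar K]) e :
  injective (fun x : K => x ^+ (p ^ e)).
Proof.
move=> x y /= /eqP; rewrite -subr_eq0 -(exprB_pchar charK) expf_eq0.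
by case/andP=> _; rewrite subr_eq0 => /eqP.
Qed.

(** If [u] were not zero, its image [u^phi] under the Frobenius map would have a
    root [z] in common with [(X - z) ^ p], the image of [X ^ p - z].  So the gcd
    of [u] and [X ^ p - z] has as image a power [c (X - z) ^ k] with [0 < k < p];
    its two top coefficients [c] and [- c k z] are then [p]-th powers, and so is
    [z]. *)
Lemma pth_power_independence1 p (K : fieldType) (charK : p \in [pchar K]) (z : K)
    (zNp : forall w, z != w ^+ p) (u : {poly K}) :
  (size u <= p)%N -> \sum_(i < size u) u`_i ^+ p * z ^+ i = 0 -> u = 0.
Proof.
move=> su u0; apply: contraTeq isT => un0.
have p_pr := pcharf_prime charK.
pose phi : {rmorphism K -> K} := pFrobenius_aut charK.
have phiE a : phi a = a ^+ p by [].
have rt : root (map_poly phi u) z.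
  rewrite /root horner_poly; apply/eqP; rewrite -[RHS]u0.
  by apply: eq_bigr => i _; rewrite phiE.
have charP : p \in [pchar {poly K}] by rewrite pchar_poly.
have XpE : map_poly phi ('X^p - z%:P) = ('X - z%:P) ^+ p.
  rewrite rmorphB /= map_polyXn map_polyC /= phiE.
  by rewrite -{3}(expn1 p) (exprB_pchar charP) expn1 -polyC_exp.
pose g := gcdp u ('X^p - z%:P).
have gE : map_poly phi g = gcdp (map_poly phi u) (('X - z%:P) ^+ p).
  by rewrite /g gcdp_map XpE.
have gn0 : g != 0 by rewrite gcdp_eq0 negb_and un0.
have sg : (size g <= p)%N by apply: leq_trans (dvdp_leq un0 (dvdp_gcdl _ _)) su.
have gz : root (map_poly phi g) z.
  rewrite gE root_gcd rt rootE horner_exp hornerXsubC subrr /=.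
  by rewrite expr0n gtn_eqF ?prime_gt0.
have : map_poly phi g %| ('X - z%:P) ^+ p by rewrite gE dvdp_gcdr.
case/dvdp_exp_XsubCP=> k kp gk.
have sk : size (map_poly phi g) = k.+1.
  by rewrite (eqp_size gk) size_exp_XsubC.
have k0 : (0 < k)%N.
  case: k gk {kp sk} => // gk; move: gz; rewrite (eqp_root gk) expr0 rootE.
  by rewrite hornerC oner_eq0.
have kltp : (k < p)%N by rewrite -sk size_map_poly.
case/eqpP: (gk) => [[c1 c2]] /andP[/= c1n0 c2n0] cE.
pose c := c2 / c1.
have gcE : map_poly phi g = c *: ('X - z%:P) ^+ k.
  apply: (scalerI c1n0); rewrite cE scalerA /c mulrCA mulfV // mulr1 //.
have top : (map_poly phi g)`_k = c.
  rewrite gcE coefZ; have := lead_coef_exp ('X - z%:P) k.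
  rewrite lead_coefXsubC expr1n lead_coefE size_exp_XsubC /= => ->.
  by rewrite mulr1.
have sub : (map_poly phi g)`_k.-1 = - (c * (k%:R * z)).
  rewrite gcE coefZ addrC exprDn coef_sum.
  case: k k0 {kp sk gk kltp cE gcE top} => // k _ /=.
  rewrite big_ord_recr big_ord_recr /= big1 ?add0r.
    rewrite subnn subSn // subnn expr1 expr0 mul1r coefMn coefMn coefXn.
    rewrite -polyCN coefCM coefXn eqxx binSn binn mulr1n.
    by rewrite eqn_leq ltnn andbF addr0 mulr1 mulNrn mulrN mulr_natl.
  move=> i _; rewrite coefMn -polyCN -polyC_exp coefCM coefXn.
  by rewrite gtn_eqF ?ltn_ord // mulr0 mul0rn.
have cn0 : c != 0 by rewrite mulf_neq0 ?invr_neq0.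
have kn0 : k%:R != 0 :> K by apply: (natr_lt_pchar charK); rewrite k0 kltp.
case/negP: (zNp (- (g`_k.-1 / (k%:R * g`_k)))); apply/eqP.
have E1 : g`_k ^+ p = c by rewrite -top coef_map.
have E2 : g`_k.-1 ^+ p = - (c * (k%:R * z)) by rewrite -sub coef_map.
have Np (a : K) : (- a) ^+ p = - (a ^+ p) by have := exprN_pchar charK 1 a; rewrite expn1.
rewrite Np expr_div_n exprMn E1 E2.
have -> : k%:R ^+ p = k%:R :> K by exact: (pFrobenius_aut_nat charK k).
rewrite mulNr opprK; apply: (canRL (mulfK _)); first by rewrite mulf_neq0.
by rewrite mulrC -mulrA mulrCA.
Qed.

(** The case [r = 1], applied to the [p ^ (r - 1)]-th powers of the [u_i]. *)
Lemma pth_power_independence p (K : fieldType) (charK : p \in [pchar K]) (z : K)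
    (zNp : forall w, z != w ^+ p) m r (u : 'I_m -> K) :
  (0 < r)%N -> (m <= p)%N -> \sum_(i < m) u i ^+ (p ^ r) * z ^+ i = 0 ->
  forall i, u i = 0.
Proof.
case: r => // r _ mp u0.
pose U := \poly_(i < m) (if insub i is Some j then u j ^+ (p ^ r) else 0).
have UE (i : 'I_m) : U`_i = u i ^+ (p ^ r).
  by rewrite coef_poly ltn_ord valK.
have U0 : U = 0.
  apply: (pth_power_independence1 charK zNp).
    by apply: leq_trans mp; apply: size_poly.
  rewrite -[RHS]u0.
  rewrite -(big_mkord xpredT (fun i => U`_i ^+ p * z ^+ i)).
  rewrite (eq_bigr (fun i : 'I_m => U`_i ^+ p * z ^+ i)); last first.
    by move=> i _; rewrite UE -exprM -expnSr.
  rewrite -(big_mkord xpredT (fun i => U`_i ^+ p * z ^+ i)).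
  rewrite [RHS](@big_cat_nat _ _ _ (size U)) ?size_poly //=.
  rewrite [X in _ + X]big_nat_cond [X in _ + X]big1 ?addr0 // => i /andP[/andP[si _] _].
  by rewrite nth_default // expr0n gtn_eqF ?mul0r // prime_gt0 // (pcharf_prime charK).
move=> i; apply: (expr_pchar_inj charK (e := r)) => /=.
by rewrite -UE U0 coef0 (expr0_pchar charK).
Qed.

Lemma interpolation_exists (K : fieldType) (I : eqType) (s : seq I) (a b : I -> K) :
  uniq [seq a i | i <- s] ->
  exists2 h : {poly K}, (size h <= size s)%N & {in s, forall i, h.[a i] = b i}.
Proof.
elim: s => [|i s IHs] /=; first by exists 0; rewrite ?size_poly0.
case/andP=> ai us; have [h sh hE] := IHs us.
pose w := \prod_(j <- s) ('X - (a j)%:P).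
have wi : w.[a i] != 0.
  have := root_prod_XsubC [seq a j | j <- s] (a i).
  by rewrite big_map (negPf ai) rootE => /negbT.
have sw : size w = (size s).+1 by rewrite size_prod_XsubC.
exists (h + ((b i - h.[a i]) / w.[a i]) *: w).
  rewrite (leq_trans (size_polyD _ _)) // geq_max (leq_trans sh) //=.
  by rewrite (leq_trans (size_scale_leq _ _)) ?sw.
move=> j; rewrite inE hornerD hornerZ => /orP[/eqP->|js].
  by rewrite divfK // addrC subrK.
rewrite hE //.
suff -> : w.[a j] = 0 by rewrite mulr0 addr0.
have := root_prod_XsubC [seq a j | j <- s] (a j).
by rewrite big_map map_f // rootE => /eqP.
Qed.

Lemma poly_eq_on_roots (K : idomainType) (s : seq K) (h g : {poly K}) :
  uniq s -> (size h <= size s)%N -> (size g <= size s)%N ->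
  {in s, forall a, h.[a] = g.[a]} -> h = g.
Proof.
move=> us sh sg hg; apply/eqP; rewrite -subr_eq0; apply/eqP.
apply: contraTeq isT => hgn0.
have rs : all (root (h - g)) s.
  by apply/allP=> a /hg; rewrite rootE hornerD hornerN => ->; rewrite subrr.
have := max_poly_roots hgn0 rs us; rewrite ltnNge => /negP; case.
by rewrite (leq_trans (size_polyD _ _)) // size_polyN geq_max sh.
Qed.

(** The derivative at a root [a] is the value at [a] of the quotient by [X - a];
    if this were zero, the quotient would have more roots than its degree. *)
Lemma deriv_at_simple_root (K : fieldType) (s : seq K) (A : {poly K}) (a : K) :
  uniq s -> A != 0 -> (size A <= (size s).+1)%N -> all (root A) s -> a \in s ->
  A^`().[a] != 0.
Proof.
move=> us An0 sA rA as_.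
have/factor_theorem [B AE] : root A a by apply: (allP rA).
have Bn0 : B != 0 by apply: contraNneq An0 => B0; rewrite AE B0 mul0r.
rewrite AE derivM hornerD !hornerM hornerXsubC subrr mulr0 add0r.
rewrite derivXsubC hornerC mulr1; apply/negP => Ba.
have rB : all (root B) s.
  apply/allP=> b bs; have := allP rA b bs; rewrite AE rootM root_XsubC.
  by case/orP=> // /eqP->.
have := max_poly_roots Bn0 rB us.
move: sA; rewrite AE size_mul ?polyXsubC_eq0 // size_XsubC addnC /= ltnS.
by move=> h1 h2; move: (leq_trans h2 h1); rewrite ltnn.
Qed.

(** Every permutation sends some index of [I] into [J], since [J] is too large
    for its complement to contain the image of [I]: all terms of the Leibniz
    formula vanish. *)
Lemma det_zero_block (R : comNzRingType) m (A : 'M[R]_m) (I J : {set 'I_m}) :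
  (forall i j, i \in I -> j \in J -> A i j = 0) -> (m < #|I| + #|J|)%N ->
  \det A = 0.
Proof.
move=> A0 cIJ; rewrite /determinant big1 // => s _.
have [i iI sJ] : exists2 i, i \in I & s i \in J.
  apply/exists_inP; apply: contraTT cIJ; rewrite negb_exists_in => /forall_inP H.
  rewrite -leqNgt -(card_imset (mem I) (@perm_inj _ s)).
  have/subset_leq_card : [set s i | i in I] \subset ~: J.
    by apply/subsetP=> _ /imsetP[i iI ->]; rewrite inE H.
  move=> h1; have h2 := cardsC J; rewrite card_ord in h2.
  by rewrite addnC -[leqRHS]h2 leq_add2l.
by rewrite (bigD1 i) //= A0 // mul0r mulr0.
Qed.

(** * From the determinant to relations between the coordinates *)

Lemma sum_ord_neq0_rev (V : nmodType) n (G : nat -> 'I_n.+1 -> V) :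
  \sum_(j < n.+1 | j != ord0) G (n - j)%N j = \sum_(k < n) G k (inord (n - k)).
Proof.
rewrite big_mkcond big_ord_recl /= add0r (reindex_inj rev_ord_inj) /=.
apply: eq_bigr => k _.
have -> : lift ord0 (rev_ord k) = inord (n - k).
  apply: val_inj; rewrite /= inordK ?ltnS ?leq_subr // /bump /=.
  by rewrite add1n -subSn.
by congr G; rewrite /bump /=; have := ltn_ord k; lia.
Qed.

Lemma sum_ord_last (V : nmodType) n (G : nat -> V) :
  (0 < n)%N -> \sum_(k < n) G k = \sum_(k < n.-1) G k + G n.-1.
Proof. by case: n => // n _; rewrite big_ord_recr. Qed.

Section Gamma.
Variables (R : comNzRingType) (p r n : nat).
Implicit Type x : 'I_n.+1 -> R.

Definition Fval x : R := polF p n r (fun i => x (inord i)).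

(** The derivative of [Fval] along [x_1]: the coefficients [x_k ^ (p ^ r)] count
    as constants. *)
Definition dFval x : R :=
  \sum_(k < n.+1 | k != ord0)
    x k ^+ (p ^ r) * (x (inord 1) ^+ (n - k).-1 *+ (n - k)).

(** Their [p ^ s_i]-th powers, evaluated at a point of the curve, are the
    coefficients of the hyperplanes with contact of order [p ^ s_i] there. *)
Definition gamma x (j : 'I_n.+1) : R :=
  if j == ord0 then - Fval x else x (inord 1) ^+ (n - j).

Definition dgamma x (j : 'I_n.+1) : R :=
  if j == ord0 then - dFval x else x (inord 1) ^+ (n - j).-1 *+ (n - j).

Lemma FvalE x :
  Fval x = \sum_(j < n.+1 | j != ord0) x j ^+ (p ^ r) * x (inord 1) ^+ (n - j).
Proof.
rewrite (sum_ord_neq0_rev (fun k j => x j ^+ (p ^ r) * x (inord 1) ^+ k)).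
by rewrite /Fval /polF big_mkord.
Qed.

End Gamma.

Section IncreasingExponents.
Variables (n : nat) (s : nat -> nat).
Hypothesis s_incr : forall i j, (1 <= i)%N -> (i < j)%N -> (j < n)%N -> (s i < s j)%N.

Lemma increasing_inj i j : (0 < i < n)%N -> (0 < j < n)%N -> s i = s j -> i = j.
Proof.
move=> /andP[i0 iN] /andP[j0 jN] sij; case: (ltngtP i j) => // h.
  by have := s_incr i0 h jN; rewrite sij ltnn.
by have := s_incr j0 h iN; rewrite sij ltnn.
Qed.

Lemma uniq_powers p e (K : nzRingType) (y : K) :
  (1 < p)%N -> injective (fun a => y ^+ a) ->
  uniq [seq y ^+ (p ^ (s i + e)) | i <- iota 1 n.-1].
Proof.
move=> p_gt1 y_inj; rewrite map_inj_in_uniq ?iota_uniq // => i j.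
rewrite !mem_iota => hi hj /y_inj /eqP; rewrite eqn_exp2l // eqn_add2r => /eqP.
by apply: increasing_inj; lia.
Qed.

End IncreasingExponents.

Section CoreRelation.
Variables (p n r : nat) (s : nat -> nat) (K : fieldType) (x : 'I_n.+1 -> K).
Local Notation z := (x (inord 1)).
Local Notation f := (Fval p r x).
Hypotheses (p_gt1 : (1 < p)%N) (n_ge2 : (2 <= n)%N).
Hypothesis s_incr : forall i j, (1 <= i)%N -> (i < j)%N -> (j < n)%N -> (s i < s j)%N.
Hypothesis z_inj : injective (fun a => z ^+ a).
Hypothesis detS : \det (mxS p n r s (fun i => x (inord i))) = 0.

(** A kernel vector, normalized so that its last coordinate is [-1].  That
    coordinate cannot vanish, otherwise the remaining ones would be the
    coefficients of a polynomial of degree at most [n - 2] with [n - 1] roots. *)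
Lemma interpolating_poly : exists V : {poly K},
  [/\ (size V <= n)%N, V`_n.-1 = z ^+ (p ^ r), V.[z] = f &
   forall i, (0 < i < n)%N -> V.[z ^+ (p ^ (s i + r))] = f ^+ (p ^ (s i + r))].
Proof.
move/eqP: detS; rewrite -det_tr => /det0P[v vn0 vM].
pose V := \poly_(k < n) v 0 (inord k).
have row_eq (i : nat) : (i < n)%N ->
    V.[z ^+ row_exponent p n r s i] + v 0 ord_max * f ^+ row_exponent p n r s i = 0.
  move=> iN; have := congr1 (fun u : 'rV_n.+1 => u 0 (inord i)) vM.
  rewrite !mxE big_ord_recr /= => E; rewrite -[RHS]E {E}; congr (_ + _).
    rewrite horner_poly; apply: eq_bigr => k _.
    rewrite !mxE inordK ?ltnS ?(ltnW iN) // iN /= ltn_ord exprM -!exprM mulnC.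
    by congr (v _ _ * _); apply: val_inj; rewrite /= inordK // ltnS ltnW.
  by rewrite !mxE inordK ?ltnS ?(ltnW iN) // iN /= ltnn.
have last_eq : V`_n.-1 + v 0 ord_max * z ^+ (p ^ r) = 0.
  have n1 : (n.-1 < n)%N by lia.
  have := congr1 (fun u : 'rV_n.+1 => u 0 ord_max) vM.
  rewrite !mxE big_ord_recr /= => E; rewrite -[RHS]E {E}; congr (_ + _).
    rewrite coef_poly n1 (bigD1 (Ordinal n1)) //= big1 ?addr0.
      rewrite !mxE /= ltnn n1 ltnn mulr1; congr (v _ _).
      by apply: val_inj; rewrite /= inordK // ltnS ltnW.
    move=> k; rewrite -val_eqE /= => kn; rewrite !mxE /= ltnn.
    by rewrite ifT ?mulr0 //; have := ltn_ord k; lia.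
  by rewrite !mxE /= ltnn; congr (_ * _); rewrite ifF //; lia.
have rowS i : (0 < i < n)%N -> exists2 k, (k < n)%N & row_exponent p n r s k = (p ^ (s
  i + r))%N.
  move=> hi; exists (n.-1 - i)%N; first lia.
  by rewrite /row_exponent ifT ?subKn //; lia.
have row1 : exists2 k, (k < n)%N & row_exponent p n r s k = 1%N.
  by exists n.-1; [lia | rewrite /row_exponent ltnn].
have vmax : v 0 ord_max != 0.
  apply: contraNneq vn0 => vm0.
  have V0 : V = 0.
    have sV : (size V <= n.-1)%N.
      apply/leq_sizeP => j jn; case: (ltnP j n) => jn'; last first.
        by rewrite nth_default // (leq_trans (size_poly _ _)).
      have -> : j = n.-1 by lia.
      by move: last_eq; rewrite vm0 mul0r addr0.
    apply: (poly_eq_on_roots (uniq_powers s_incr r p_gt1 z_inj));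
      rewrite ?size_poly0 ?size_map ?size_iota //.
    move=> y /mapP[i hi ->{y}]; move: hi; rewrite mem_iota => hi; rewrite horner0.
    have [|k kn kE] := rowS i; first lia.
    by have := row_eq k kn; rewrite kE vm0 mul0r addr0.
  apply/eqP/rowP => k; rewrite mxE; case: (ltnP k n) => kn.
    have := congr1 (fun q : {poly K} => q`_k) V0; rewrite coef_poly kn coef0 => <-.
    by congr (v _ _); apply: val_inj; rewrite /= inordK.
  by rewrite -vm0; congr (v _ _); apply: val_inj => /=; have := ltn_ord k; lia.
have VE i : (i < n)%N -> ((- v 0 ord_max)^-1 *: V).[z ^+ row_exponent p n r s i] =
    f ^+ row_exponent p n r s i.
  move=> iN; rewrite hornerZ; have /eqP := row_eq i iN; rewrite addr_eq0 => /eqP ->.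
  by rewrite -mulNr mulKf // oppr_eq0.
exists ((- v 0 ord_max)^-1 *: V); split.
- by rewrite (leq_trans (size_scale_leq _ _)) // size_poly.
- rewrite coefZ; move/eqP: last_eq; rewrite addr_eq0 => /eqP ->.
  by rewrite -mulNr mulKf // oppr_eq0.
- by have [k kn kE] := row1; have := VE k kn; rewrite kE !expr1.
- by move=> i /rowS[k kn <-]; apply: VE.
Qed.

Hypotheses (charK : p \in [pchar K]) (n_lt_p : (n < p)%N) (r_gt0 : (0 < r)%N).
Hypotheses (x0 : x ord0 = 1) (zNp : forall w, z != w ^+ p).

(** The polynomial [h] interpolates the [p ^ r]-th roots of the values prescribed
    by the rows [E = p ^ (s_i + r)], so [H], with coefficients [h_k ^ (p ^ r)],
    coincides with [V] up to the top coefficient; the row [E = 1] then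
    identifies [h_k] with [x_(n - k)]. *)
Lemma core_relation i : (0 < i < n)%N ->
  \sum_j gamma p r x j ^+ (p ^ s i) * x j = 0.
Proof.
have [V [sV Vtop Vz VZ]] := interpolating_poly.
(* the values left after the known top term of [V] is removed, with their
   [p ^ r]-th roots taken *)
pose b i := f ^+ (p ^ s i) - z * z ^+ (p ^ s i) ^+ n.-1.
have us := uniq_powers s_incr 0 p_gt1 z_inj.
have [h] := interpolation_exists b us.
rewrite size_iota => sh hE.
pose W := V - z ^+ (p ^ r) *: 'X^(n.-1).
pose H := \poly_(k < n.-1) h`_k ^+ (p ^ r).
have sW : (size W <= n.-1)%N.
  apply/leq_sizeP => j jn; rewrite coefB coefZ coefXn.
  have [->|jn'] := eqVneq j n.-1; first by rewrite Vtop mulr1 subrr.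
  rewrite mulr0 subr0 nth_default // (leq_trans sV) //.
  by move: jn jn'; case: (ltngtP j n.-1) => //; case: (n) => [|m]; lia.
have HE y : H.[y ^+ (p ^ r)] = h.[y] ^+ (p ^ r).
  rewrite horner_poly (horner_coef_wide _ sh) (expr_sum_pchar charK).
  by apply: eq_bigr => k _; rewrite exprMn -!exprM mulnC.
have WH : W = H.
  apply: (poly_eq_on_roots (uniq_powers s_incr r p_gt1 z_inj));
    rewrite ?size_map ?size_iota ?size_poly //.
  move=> y /mapP[l hl ->{y}]; move: hl; rewrite mem_iota => hl.
  rewrite expnD exprM HE -exprM -expnD.
  have := hE l; rewrite mem_iota addn0 => -> //.
  rewrite /W hornerD hornerN hornerZ hornerXn VZ; last by lia.
  by rewrite /b (exprB_pchar charK) exprMn -!exprM -!expnD -!mulnA [(n.-1 * _)%N]mulnC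
    mulnA -expnD.
have hx (k : 'I_n.-1) : h`_k = x (inord (n - k)).
  apply/eqP; rewrite -subr_eq0; apply/eqP.
  pose u (k : 'I_n.-1) := h`_k - x (inord (n - k)).
  apply: (pth_power_independence charK zNp (r := r) (u := u)) => //; first by lia.
  rewrite /u; under eq_bigr do rewrite (exprB_pchar charK) mulrBl.
  rewrite sumrB -(horner_poly _ (fun k => h`_k ^+ (p ^ r))) -/H -WH.
  rewrite /W hornerD hornerN hornerZ hornerXn Vz FvalE.
  rewrite (sum_ord_neq0_rev (fun k j => x j ^+ (p ^ r) * z ^+ k)).
  rewrite (sum_ord_last (fun k => x (inord (n - k)) ^+ (p ^ r) * z ^+ k)); last by lia.
  by rewrite (_ : n - n.-1 = 1)%N ?addrK ?subrr //; lia.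
move=> iN; rewrite (bigD1 ord0) //= {1}/gamma eqxx x0 mulr1 (exprN_pchar charK).
rewrite (eq_bigr (fun j : 'I_n.+1 => z ^+ (p ^ s i) ^+ (n - j) * x j)); last first.
  by move=> j /negPf j0; rewrite /gamma j0 -!exprM mulnC.
rewrite (sum_ord_neq0_rev (fun k j => z ^+ (p ^ s i) ^+ k * x j)).
rewrite (sum_ord_last (fun k => z ^+ (p ^ s i) ^+ k * x (inord (n - k)))); last by lia.
rewrite (_ : n - n.-1 = 1)%N; last by lia.
have := hE i; rewrite mem_iota addn0 (horner_coef_wide _ sh) /b => hEi.
have {hEi} /eqP := hEi ltac:(lia); rewrite (mulrC z) eq_sym subr_eq => /eqP ->.
rewrite addrC; apply/eqP; rewrite subr_eq0; apply/eqP; congr (_ + _).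
by apply: eq_bigr => k _; rewrite hx mulrC.
Qed.

End CoreRelation.

(** * Partial morphisms to dual numbers *)

Section EvalX.
Variables (L K : fieldType) (kappa : {rmorphism L -> K}) (w : K).

(** A ring morphism in [a], so that [map_poly evalX] specializes the first
    variable of a bivariate polynomial. *)
Definition evalX (a : {poly L}) : K := (map_poly kappa a).[w].

Fact evalX_is_zmod_morphism : zmod_morphism evalX.
Proof. by move=> a b; rewrite /evalX rmorphB hornerD hornerN. Qed.

Fact evalX_is_monoid_morphism : monoid_morphism evalX.
Proof.
by split=> [|a b]; rewrite /evalX ?rmorph1 ?hornerC // rmorphM hornerM.
Qed.

HB.instance Definition _ :=
  GRing.isZmodMorphism.Build {poly L} K evalX evalX_is_zmod_morphism.
HB.instance Definition _ :=
  GRing.isMonoidMorphism.Build {poly L} K evalX evalX_is_monoid_morphism.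

Lemma evalXX : evalX 'X = w.
Proof. by rewrite /evalX map_polyX hornerX. Qed.

Lemma evalXC c : evalX c%:P = kappa c.
Proof. by rewrite /evalX map_polyC hornerC. Qed.

Lemma evalXMXaddC a c : evalX (a * 'X + c%:P) = evalX a * w + kappa c.
Proof. by rewrite rmorphD rmorphM /= evalXX evalXC. Qed.

End EvalX.
Arguments evalX : simpl never.

(** [J y c e] says that [y] is mapped to [c + e eps] by a ring morphism to the dual
    numbers over [k], defined on a part of [K].  A relation is used instead of a
    function since at a point of a curve only the functions without a pole have
    an image. *)
Record dual_values (L K k : fieldType) (kappa : {rmorphism L -> K})
    (lam : {rmorphism L -> k}) (J : K -> k -> k -> Prop) : Prop := DualValues {
  dv_const : forall c, J (kappa c) (lam c) 0;
  dv_add : forall y c e y' c' e',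
    J y c e -> J y' c' e' -> J (y + y') (c + c') (e + e');
  dv_mul : forall y c e y' c' e',
    J y c e -> J y' c' e' -> J (y * y') (c * c') (c * e' + e * c');
  dv_uniq : forall y c e c' e', J y c e -> J y c' e' -> c = c' /\ e = e' }.

Section DualValues.
Variables (L K k : fieldType) (kappa : {rmorphism L -> K}).
Variables (lam : {rmorphism L -> k}) (J : K -> k -> k -> Prop).
Hypothesis dvJ : dual_values kappa lam J.

Lemma dv0 : J 0 0 0.
Proof. by have := dv_const dvJ 0; rewrite !rmorph0. Qed.

Lemma dv1 : J 1 1 0.
Proof. by have := dv_const dvJ 1; rewrite !rmorph1. Qed.

Lemma dvN y c e : J y c e -> J (- y) (- c) (- e).
Proof.
have := dv_const dvJ (-1); rewrite !rmorphN1 => h /(dv_mul dvJ h).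
by rewrite !mulN1r mul0r addr0.
Qed.

Lemma dvX y c e m : J y c e -> J (y ^+ m) (c ^+ m) (c ^+ m.-1 *+ m * e).
Proof.
move=> Jy; elim: m => [|m IHm]; first by rewrite !expr0 mulr0n mul0r; apply: dv1.
have := dv_mul dvJ Jy IHm; rewrite -!exprS; congr J.
case: m {IHm} => [|m]; first by rewrite /= !expr0 mulr0n mulr1n mul0r mulr0 add0r mul1r
  mulr1.
by rewrite /= mulrA mulrnAr -exprS [e * _]mulrC -mulrDl -mulrSr.
Qed.

Lemma dvMn y c e m : J y c e -> J (y *+ m) (c *+ m) (e *+ m).
Proof.
move=> Jy; elim: m => [|m IHm]; first by rewrite !mulr0n; apply: dv0.
by rewrite !mulrS; apply: (dv_add dvJ).
Qed.

Lemma dv_sum I (s : seq I) (P : pred I) (Y : I -> K) (C E : I -> k) :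
  (forall i, P i -> J (Y i) (C i) (E i)) ->
  J (\sum_(i <- s | P i) Y i) (\sum_(i <- s | P i) C i) (\sum_(i <- s | P i) E i).
Proof.
move=> JY; elim: s => [|i s IHs]; first by rewrite !big_nil; apply: dv0.
by rewrite !big_cons; case: ifP => [Pi|//]; apply: (dv_add dvJ); [apply: JY|].
Qed.

Lemma dv_pexp p (chark : p \in [pchar k]) m y c e :
  (0 < m)%N -> J y c e -> J (y ^+ (p ^ m)) (c ^+ (p ^ m)) 0.
Proof.
move=> m0 /(dvX (p ^ m)); rewrite -mulr_natr.
by rewrite (pchar_natX chark) // mulr0 mul0r.
Qed.

(** Differentiating [m(z, y) = 0] gives [(dm/dY) e = 0] when the derivative of
    [z] is zero: this is how separability over [z] makes [z] govern all
    derivatives. *)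
Lemma dv_algebraic z a y b e (m : {poly {poly L}}) :
  J z a 0 -> J y b e ->
  (map_poly (evalX kappa z) m).[y] = 0 ->
  (map_poly (evalX lam a) m)^`().[b] != 0 -> e = 0.
Proof.
move=> Jz Jy; pose mz q := map_poly (evalX kappa z) q.
pose ma q := map_poly (evalX lam a) q.
have Jc (q : {poly L}) : J (evalX kappa z q) (evalX lam a q) 0.
  elim/poly_ind: q => [|q c IHq]; first by rewrite !rmorph0; apply: dv0.
  rewrite !evalXMXaddC.
  have := dv_add dvJ (dv_mul dvJ IHq Jz) (dv_const dvJ c).
  by rewrite mulr0 mul0r !addr0.
have Jm : J (mz m).[y] (ma m).[b] ((ma m)^`().[b] * e).
  elim/poly_ind: m => [|q c IHq].
    by rewrite /mz /ma !rmorph0 deriv0 !horner0 mul0r; apply: dv0.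
  rewrite /mz /ma !rmorphD !rmorphM /= !map_polyX !map_polyC /= !hornerMXaddC.
  rewrite -/(mz q) -/(ma q).
  have := dv_add dvJ (dv_mul dvJ IHq Jy) (Jc c).
  rewrite addr0 derivD derivM derivX derivC addr0 mulr1 hornerD hornerMX.
  by congr J; rewrite mulrDl addrC -mulrA [b * e]mulrC mulrA.
rewrite -/(mz m) -/(ma m) => mz0 man0; move: Jm; rewrite mz0 => /(dv_uniq dvJ dv0) [_].
by move/esym/eqP; rewrite mulf_eq0 (negPf man0) => /eqP.
Qed.

Lemma dv_mpoly0 m (x : 'I_m -> K) (a : 'I_m -> k) (f : {mpoly L[m]}) :
  (forall j, J (x j) (a j) 0) -> J (mmap kappa x f) (mmap lam a f) 0.
Proof.
move=> Jx; elim/mpolyind: f => [|c m' f _ _ IHf]; first by rewrite !mmap0; apply: dv0.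
rewrite !mmapD !mmapZ !mmapX.
have Jm : J (mmap1 x m') (mmap1 a m') 0.
  rewrite /mmap1; elim/big_rec2: _ => [|i b y _ IH]; first exact: dv1.
  by have := dv_mul dvJ (dvX (m' i) (Jx i)) IH; rewrite !mulr0 mul0r addr0.
have := dv_add dvJ (dv_mul dvJ (dv_const dvJ c) Jm) IHf.
by rewrite !(mulr0, mul0r, addr0).
Qed.

Lemma dv_not_pth_power p (chark : p \in [pchar k]) z a e w b e' :
  J z a e -> e != 0 -> J w b e' -> z != w ^+ p.
Proof.
move=> Jz en0 Jw; apply: contraNneq en0 => zw.
have := dv_pexp chark (isT : (0 < 1)%N) Jw; rewrite expn1 -zw => /(dv_uniq dvJ Jz).
by case=> _ ->.
Qed.

Section Gamma.
Variables (p n r : nat) (s : nat -> nat).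
Variables (x : 'I_n.+1 -> K) (a d : 'I_n.+1 -> k).
Hypotheses (chark : p \in [pchar k]) (r_gt0 : (0 < r)%N) (n_ge2 : (2 <= n)%N).
Hypothesis (Jx : forall j, J (x j) (a j) (d j)).
Let i1 : 'I_n.+1 := inord 1.

Lemma dv_gamma j : J (gamma p r x j) (gamma p r a j) (dgamma p r a j * d i1).
Proof.
rewrite /gamma /dgamma; case: eqP => _; last exact: dvX.
rewrite !FvalE /dFval mulNr mulr_suml; apply: dvN; apply: dv_sum => i _.
have := dv_mul dvJ (dv_pexp chark r_gt0 (Jx i)) (dvX (n - i) (Jx i1)).
by rewrite mul0r addr0 mulrA.
Qed.

Lemma dv_dgamma j : exists e, J (dgamma p r x j) (dgamma p r a j) e.
Proof.
rewrite /dgamma; case: eqP => _; last by eexists; apply/dvMn/dvX/Jx.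
eexists; apply/dvN/dv_sum => i _.
apply: (dv_mul dvJ (dv_pexp chark r_gt0 (Jx i))); apply/dvMn/dvX/Jx.
Qed.

Hypothesis s_gt0 : forall i, (0 < i < n)%N -> (0 < s i)%N.
Hypothesis x0 : x ord0 = 1.
Hypothesis a_uniq : uniq [seq a i1 ^+ (p ^ s i) | i <- iota 1 n.-1].
Hypothesis d1 : d i1 != 0.
Hypothesis rel : forall i, (0 < i < n)%N -> \sum_j gamma p r x j ^+ (p ^ s i) * x j = 0.

(** The polynomial [A] below has the roots [a_1 ^ (p ^ s_l)], by differentiation of
    the relations, and they are simple for lack of room; differentiating
    [sum_j gamma'_j ^ (p ^ s_i) x_j = 0] would produce a multiple one. *)
Lemma dgamma_relation_neq0 (n_lt_p : (n < p)%N) i : (0 < i < n)%N ->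
  \sum_j dgamma p r x j ^+ (p ^ s i) * x j != 0.
Proof.
move=> hi; apply/negP => /eqP G0.
have d0 : d ord0 = 0.
  by have := Jx ord0; rewrite x0 => /(dv_uniq dvJ dv1)[_ <-].
have gam_d l : (0 < l < n)%N -> \sum_j gamma p r a j ^+ (p ^ s l) * d j = 0.
  move=> hl; have := rel hl.
  have : J (\sum_j gamma p r x j ^+ (p ^ s l) * x j)
    (\sum_j gamma p r a j ^+ (p ^ s l) * a j) (\sum_j gamma p r a j ^+ (p ^ s l) * d j).
    apply: dv_sum => j _.
    have := dv_mul dvJ (dv_pexp chark (s_gt0 hl) (dv_gamma j)) (Jx j).
    by rewrite mul0r addr0.
  by move=> h h0; move: h; rewrite h0 => /(dv_uniq dvJ dv0)[_ <-].
have dgam_d : \sum_j dgamma p r a j ^+ (p ^ s i) * d j = 0.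
  have : J (\sum_j dgamma p r x j ^+ (p ^ s i) * x j)
    (\sum_j dgamma p r a j ^+ (p ^ s i) * a j) (\sum_j dgamma p r a j ^+ (p ^ s i) * d j).
    apply: dv_sum => j _; have [e Je] := dv_dgamma j.
    have := dv_mul dvJ (dv_pexp chark (s_gt0 hi) Je) (Jx j).
    by rewrite mul0r addr0.
  by rewrite G0 => /(dv_uniq dvJ dv0)[_ <-].
(* [d_0 = 0] as [x_0] is constant, so [gamma_0] does not contribute, and
   [A] evaluated at [a_1 ^ (p ^ s_l)] is the differentiated relation *)
pose A := \sum_(j < n.+1 | j != ord0) d j *: 'X^(n - j).
have sA : (size A <= n)%N.
  apply: leq_trans (size_sum _ _ _) _; apply/bigmax_leqP => j j0.
  rewrite (leq_trans (size_scale_leq _ _)) // size_polyXn.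
  by move: j0; rewrite -val_eqE /=; lia.
have i1v : i1 = 1%N :> nat by rewrite /i1 inordK //; lia.
have An0 : A != 0.
  apply: contraNneq d1 => A0; have := congr1 (fun q : {poly k} => q`_n.-1) A0.
  rewrite coef0 coef_sum (bigD1 i1) /=; last by rewrite -val_eqE /= i1v.
  rewrite coefZ coefXn i1v (_ : n.-1 == n - 1)%N; last by lia.
  rewrite mulr1 big1 ?addr0 => [->//|j /andP[j0 j1]].
  rewrite coefZ coefXn (_ : (n.-1 == n - j)%N = false) ?mulr0 //.
  move: j0 j1; rewrite -!val_eqE /= i1v; have := ltn_ord j; lia.
have := @deriv_at_simple_root _ [seq a i1 ^+ (p ^ s i) | i <- iota 1 n.-1] A (a i1 ^+
  (p ^ s i)) a_uniq An0.
rewrite size_map size_iota prednK; last by lia.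
move/(_ sA) => H.
have {H} : A^`().[a i1 ^+ (p ^ s i)] != 0.
  apply: H; last by apply/mapP; exists i => //; rewrite mem_iota; lia.
  apply/allP => y /mapP[l hl ->{y}]; move: hl; rewrite mem_iota => hl.
  rewrite rootE horner_sum; apply/eqP.
  rewrite -[RHS](gam_d l); last by lia.
  rewrite [RHS](bigD1 ord0) //= d0 mulr0 add0r; apply: eq_bigr => j /negPf j0.
  by rewrite hornerZ hornerXn /gamma j0 -!exprM mulnC mulrC.
case/negP; rewrite -dgam_d; apply/eqP.
rewrite linear_sum horner_sum [RHS](bigD1 ord0) //= d0 mulr0 add0r.
apply: eq_bigr => j /negPf j0.
rewrite derivZ derivXn hornerZ hornerMn hornerXn /dgamma j0 mulrC; congr (_ * _).
rewrite -mulr_natr -[in RHS]mulr_natr exprMn -!exprM mulnC; congr (_ * _).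
by rewrite (natr_expr_pchar chark).
Qed.
End Gamma.
End DualValues.

(** * Algebraic dependence over a simple transcendental extension *)

Section SimpleExtension.
Variables (L K : fieldType) (kappa : {rmorphism L -> K}) (w : K).

Local Notation evalX := (evalX kappa w).

(** The subfield [L(w)] of [K]. *)
Definition simple_field : {pred K} :=
  fun y => `[< exists2 b, evalX b != 0 & exists a, y = evalX a / evalX b >].

Lemma simple_fieldP y :
  reflect (exists2 b, evalX b != 0 & exists a, y = evalX a / evalX b)
    (y \in simple_field).
Proof. exact: asboolP. Qed.

Lemma evalX_in a : evalX a \in simple_field.
Proof. by apply/simple_fieldP; exists 1; [|exists a];
  rewrite rmorph1 ?oner_eq0 ?divr1. Qed.

Lemma simple_field_divring_closed : divring_closed simple_field.
Proof.
split=> [|y y' /simple_fieldP[b b0 [a ->]] /simple_fieldP[b' b'0 [a' ->]]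
         |y y' /simple_fieldP[b b0 [a ->]] /simple_fieldP[b' b'0 [a' ->]]].
- by rewrite -(rmorph1 evalX) evalX_in.
- apply/simple_fieldP; exists (b * b'); first by rewrite rmorphM mulf_neq0.
  exists (a * b' - a' * b); rewrite rmorphB !rmorphM.
  by rewrite -[in LHS]mulNr addf_div // mulNr.
- have [a'0|a'n0] := eqVneq (evalX a') 0.
    by rewrite a'0 mul0r invr0 mulr0 -(rmorph0 evalX) evalX_in.
  apply/simple_fieldP; exists (b * a'); first by rewrite rmorphM mulf_neq0.
  by exists (a * b'); rewrite !rmorphM invf_div mulf_div.
Qed.

HB.instance Definition _ :=
  GRing.isDivringClosed.Build K simple_field simple_field_divring_closed.

Record simpleF := SimpleF { simpleF_val : K; _ : simpleF_val \in simple_field }.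

HB.instance Definition _ := [isSub for simpleF_val].
HB.instance Definition _ := [Choice of simpleF by <:].
HB.instance Definition _ := [SubChoice_isSubIntegralDomain of simpleF by <:].
HB.instance Definition _ := [SubIntegralDomain_isSubField of simpleF by <:].

Definition simple_emb : {rmorphism simpleF -> K} := val.

Lemma algebraic_simple y : y \in simple_field -> algebraicOver simple_emb y.
Proof. by move=> yS; have := algebraic_id simple_emb (SimpleF yS). Qed.

End SimpleExtension.

Section AlgebraicDependence.
Variables (L K : fieldType) (kappa : {rmorphism L -> K}).
Local Notation ev w := (evalX kappa w).
Local Notation "L_( w )" := (simple_field kappa w) (at level 0, format "L_( w )").
Local Notation emb w := (simple_emb kappa w).

(** A common denominator of the coefficients is kept as the value of a polynomial
    in the stronger statement proved by induction. *)
Lemma clear_denominators w (f : {poly K}) :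
  (forall i, f`_i \in L_(w)) ->
  exists (m : {poly {poly L}}) (c : K), c != 0 /\ map_poly (ev w) m = c *: f.
Proof.
move=> fS; suff [m [b [b0 mE]]] : exists (m : {poly {poly L}}) b,
    ev w b != 0 /\ map_poly (ev w) m = ev w b *: f by exists m, (ev w b).
elim/poly_ind: f fS => [|f c IHf] fS.
  by exists 0, 1; rewrite rmorph1 oner_eq0 rmorph0 scaler0.
have [|m [b [b0 mE]]] := IHf.
  by move=> i; have := fS i.+1; rewrite coefD coefMX coefC /= addr0.
have /simple_fieldP[b' b'0 [a cE]] : c \in L_(w).
  by have := fS 0%N; rewrite coefD coefMX coefC /= add0r.
exists (b' *: m * 'X + (b * a)%:P), (b * b'); split; first by rewrite rmorphM mulf_neq0.
rewrite !rmorphD !rmorphM /= map_polyX map_polyC map_polyZ mE map_polyC /=.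
rewrite scalerDr scalerAl scalerA [ev w b' * _]mulrC; congr (_ + _).
by rewrite cE -[RHS]mul_polyC -!polyCM -mulrA [ev w b' * _]mulrC divfK.
Qed.

Lemma algebraic_horner w z a : algebraicOver (emb w) z -> algebraicOver (emb w) (ev z a).
Proof.
move=> alz; elim/poly_ind: a => [|a c IHa]; first by rewrite rmorph0; apply: algebraic0.
rewrite evalXMXaddC; apply: algebraic_add.
  exact: algebraic_mul.
by apply: algebraic_simple; rewrite -(evalXC kappa w) evalX_in.
Qed.

Lemma algebraic_trans w z (f : {poly K}) y :
  algebraicOver (emb w) z -> (forall i, f`_i \in L_(z)) -> f != 0 -> root f y ->
  algebraicOver (emb w) y.
Proof.
move=> alz fS f0 fy; apply/integral_algebraic.
apply: (integral_root f0 fy); apply/integral_poly => i.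
apply/integral_algebraic; have /simple_fieldP[b b0 [a ->]] := fS i.
by apply: algebraic_div; apply: algebraic_horner.
Qed.

Lemma algebraic_relation w y : algebraicOver (emb w) y ->
  exists2 m : {poly {poly L}}, m != 0 & (map_poly (ev w) m).[y] = 0.
Proof.
case=> p p0 py; have [|m [c [c0 mE]]] := @clear_denominators w (map_poly (emb w) p).
  by move=> i; rewrite coef_map /=; case: (p`_i).
exists m; last by rewrite mE hornerZ (rootP py) mulr0.
apply: contraNneq p0 => m0; move/esym/eqP: mE; rewrite m0 rmorph0 scaler_eq0 (negPf c0).
by rewrite map_poly_eq0.
Qed.

Lemma eval_swapXY z w (m : {poly {poly L}}) :
  (map_poly (ev w) (swapXY m)).[z] = (map_poly (ev z) m).[w].
Proof.
elim/poly_ind: m => [|m c IHm]; first by rewrite !rmorph0 !horner0.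
rewrite !rmorphD !rmorphM /= swapXY_X swapXY_polyC !map_polyX !map_polyC /=.
rewrite evalXX !hornerE IHm; congr (_ + _).
rewrite -map_poly_comp /=.
by congr (_.[_]); apply: eq_map_poly => a /=; rewrite evalXC.
Qed.

(** A relation [m(z, w) = 0] read as a polynomial in [z] is not trivial, as [w] is
    transcendental. *)
Lemma algebraic_exchange z w :
  (forall a, ev w a = 0 -> a = 0) -> algebraicOver (emb z) w ->
  algebraicOver (emb w) z.
Proof.
move=> w_tr /algebraic_relation[m m0 mw].
have w_inj : injective (ev w).
  by move=> a b /eqP; rewrite -subr_eq0 -rmorphB => /eqP/w_tr/eqP;
    rewrite subr_eq0 => /eqP.
apply: (@algebraic_trans w w (map_poly (ev w) (swapXY m))).
- by apply: algebraic_simple; rewrite -{1}(evalXX kappa w) evalX_in.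
- by move=> i; rewrite coef_map evalX_in.
- by rewrite -(rmorph0 (map_poly (ev w))) (inj_eq (map_inj_poly w_inj (rmorph0 _)))
    swapXY_eq0.
- by rewrite rootE eval_swapXY mw.
Qed.

End AlgebraicDependence.

(** * Values of functions at points *)

Lemma dhomog_homogeneous (L : fieldType) n d (f : {mpoly L[n]}) :
  f \is d.-homog -> homogeneous f.
Proof. by exists d. Qed.

Lemma dhomogX1 (L : fieldType) n (i : 'I_n) : ('X_i : {mpoly L[n]}) \is 1.-homog.
Proof. by rewrite dhomogX; apply/eqP; apply: mdeg1. Qed.

Section Values.
Variables (L : closedFieldType) (n : nat) (X : pset L n) (K : fieldType).
Variables (kappa : {rmorphism L -> K}) (x : 'I_n.+1 -> K).
Hypothesis Kff : function_field X kappa x.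
Hypothesis X_neq0 : forall P, X P -> P != 0.
Implicit Types (P Q : 'rV[L]_n.+1) (f g : {mpoly L[n.+1]}).

Lemma vanish_mmap f : homogeneous f ->
  (mmap kappa x f = 0 <-> forall P, X P -> f.@[P ord0] = 0).
Proof. by case: Kff => _ H _; apply: H. Qed.

Lemma mmap_neq0 P d f : X P -> f \is d.-homog -> f.@[P ord0] != 0 -> mmap kappa x f != 0.
Proof.
move=> XP fd; apply: contraNneq => f0.
by apply/eqP; apply: (proj1 (vanish_mmap (dhomog_homogeneous fd))).
Qed.

(** The function [y] is regular at [P] and takes the value [c] there. *)
Definition has_value P (y : K) (c : L) : Prop :=
  exists (d : nat) (f g : {mpoly L[n.+1]}),
    [/\ f \is d.-homog, g \is d.-homog, g.@[P ord0] != 0,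
        y = mmap kappa x f / mmap kappa x g & c = f.@[P ord0] / g.@[P ord0]].

Lemma in_local_ringP P y : in_local_ring kappa x P y <-> exists c, has_value P y c.
Proof.
split=> [[d [f [g [fd gd g0 ->]]]]|[c [d [f [g [fd gd g0 -> _]]]]]].
  by exists (f.@[P ord0] / g.@[P ord0]), d, f, g.
by exists d, f, g.
Qed.

Lemma in_maximal_idealP P y : in_maximal_ideal kappa x P y <-> has_value P y 0.
Proof.
split=> [[d [f [g [fd gd f0 g0 ->]]]]|[d [f [g [fd gd g0 -> /esym/eqP]]]]].
  by exists d, f, g; rewrite f0 mul0r.
rewrite mulf_eq0 invr_eq0 (negPf g0) orbF => /eqP f0.
by exists d, f, g.
Qed.

Section AtPoint.
Variables (P : 'rV[L]_n.+1) (XP : X P).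

(** Two representations of [y] by quotients of forms differ by a form which
    vanishes identically on [X]. *)
Lemma value_uniq y c c' : has_value P y c -> has_value P y c' -> c = c'.
Proof.
case=> [d [f [g [fd gd g0 -> ->]]]] [d' [f' [g' [fd' gd' g0' E ->]]]].
have mg := mmap_neq0 XP gd g0; have mg' := mmap_neq0 XP gd' g0'.
apply/eqP; rewrite eqr_div //; apply/eqP.
have h1 : f * g' - f' * g \is (d + d').-homog.
  apply: dhomogD; first exact: dhomogM.
  by rewrite dhomogN addnC; apply: dhomogM.
have := proj1 (vanish_mmap (dhomog_homogeneous h1)).
rewrite !mmapB !rmorphM /= => /(_ _ _ XP) H.
apply/eqP; rewrite -subr_eq0 -!mevalM -mevalB H //.
by apply/eqP; rewrite subr_eq0 -eqr_div //; apply/eqP.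
Qed.

Lemma value_const c : has_value P (kappa c) c.
Proof.
exists 0%N, c%:MP, 1; split.
- by rewrite -[c%:MP]mulr1 mul_mpolyC; apply/dhomogZ/dhomog1.
- exact: dhomog1.
- by rewrite meval1 oner_eq0.
- by rewrite mmapC rmorph1 divr1.
- by rewrite mevalC meval1 divr1.
Qed.

Lemma value0 : has_value P 0 0.
Proof. by have := value_const 0; rewrite rmorph0. Qed.

Lemma value1 : has_value P 1 1.
Proof. by have := value_const 1; rewrite rmorph1. Qed.

Lemma value_add y c y' c' :
  has_value P y c -> has_value P y' c' -> has_value P (y + y') (c + c').
Proof.
case=> [d [f [g [fd gd g0 -> ->]]]] [d' [f' [g' [fd' gd' g0' -> ->]]]].
have mg := mmap_neq0 XP gd g0; have mg' := mmap_neq0 XP gd' g0'.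
exists (d + d')%N, (f * g' + f' * g), (g * g'); split.
- by apply: dhomogD; [|rewrite addnC]; apply: dhomogM.
- exact: dhomogM.
- by rewrite mevalM mulf_neq0.
- by rewrite addf_div // mmapD !rmorphM.
- by rewrite addf_div // mevalD !mevalM.
Qed.

Lemma value_mul y c y' c' :
  has_value P y c -> has_value P y' c' -> has_value P (y * y') (c * c').
Proof.
case=> [d [f [g [fd gd g0 -> ->]]]] [d' [f' [g' [fd' gd' g0' -> ->]]]].
exists (d + d')%N, (f * f'), (g * g'); split.
- exact: dhomogM.
- exact: dhomogM.
- by rewrite mevalM mulf_neq0.
- by rewrite mulf_div !rmorphM.
- by rewrite mulf_div !mevalM.
Qed.

Lemma value_opp y c : has_value P y c -> has_value P (- y) (- c).
Proof.
move/(value_mul (value_const (-1))).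
by rewrite rmorphN1 !mulN1r.
Qed.

Lemma value_exp y c m : has_value P y c -> has_value P (y ^+ m) (c ^+ m).
Proof.
move=> yc; elim: m => [|m IHm]; first by rewrite !expr0; apply: value1.
by rewrite !exprS; apply: value_mul.
Qed.

Lemma value_sum I (s : seq I) (Pr : pred I) (Y : I -> K) (C : I -> L) :
  (forall i, Pr i -> has_value P (Y i) (C i)) ->
  has_value P (\sum_(i <- s | Pr i) Y i) (\sum_(i <- s | Pr i) C i).
Proof.
move=> YC; elim: s => [|i s IHs]; first by rewrite !big_nil; apply: value0.
by rewrite !big_cons; case: ifP => [Pi|//]; apply: value_add; [apply: YC|].
Qed.

Lemma value_coord i j : P ord0 i != 0 -> has_value P (x j / x i) (P ord0 j / P ord0 i).
Proof.
move=> Pi; exists 1%N, 'X_j, 'X_i; rewrite !dhomogX1 !mevalXU.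
by split=> //; rewrite !mmapX !mmap1U.
Qed.

Lemma coord_neq0 i : P ord0 i != 0 -> x i != 0.
Proof.
move=> Pi; have := @mmap_neq0 P 1 'X_i XP; rewrite dhomogX1 mevalXU mmapX mmap1U.
exact.
Qed.

Lemma value_evalX z a (q : {poly L}) :
  has_value P z a -> has_value P (evalX kappa z q) q.[a].
Proof.
move=> za; elim/poly_ind: q => [|q c IHq]; first by rewrite rmorph0 horner0;
  apply: value0.
rewrite evalXMXaddC hornerMXaddC.
by apply: value_add; [apply: value_mul | apply: value_const].
Qed.

Lemma value_eval2 z a y b (m : {poly {poly L}}) :
  has_value P z a -> has_value P y b ->
  has_value P (map_poly (evalX kappa z) m).[y] (map_poly (horner_eval a) m).[b].
Proof.
move=> za yb; elim/poly_ind: m => [|q c IHq].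
  by rewrite !rmorph0 !horner0; apply: value0.
rewrite !rmorphD !rmorphM /= !map_polyX !map_polyC /= !hornerMXaddC.
by apply: value_add; [apply: value_mul | apply: value_evalX].
Qed.

End AtPoint.

Hypothesis alg_dep : forall w y, (forall a, evalX kappa w a = 0 -> a = 0) ->
  algebraicOver (simple_emb kappa w) y.

(** Take a relation [m(w, g) = 0] whose constant term in [g] is not zero, after
    division by a power of [g].  At a zero of [g] the value of [w] is a root of
    this constant term.  If [w] is algebraic over [L], its values are roots of
    any equation of [w]. *)
Lemma finitely_many_values w (g : K) : g != 0 ->
  exists s : seq L, forall P a, X P ->
    has_value P w a -> has_value P g 0 -> a \in s.
Proof.
move=> g0; suff [q q0 qP] : exists2 q : {poly L}, q != 0 & forall P a, X P ->
    has_value P w a -> has_value P g 0 -> root q a.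
  have [s qE] := closed_field_poly_normal q; exists s => // P a XP wa g_0.
  have := qP P a XP wa g_0; rewrite qE rootZ ?lead_coef_eq0 //.
  by rewrite root_prod_XsubC.
have [w_tr|] := EM (forall a, evalX kappa w a = 0 -> a = 0); last first.
  move=> /existsNP[q /not_implyP[qw /eqP q0]]; exists q => // P a XP wa _.
  have := value_evalX XP q wa; rewrite qw => /(value_uniq XP (value0 P)) E.
  by rewrite rootE -E.
have [m1 m10 mg1] := algebraic_relation (alg_dep g w_tr).
have [m [m0 mg]] : exists m : {poly {poly L}}, m`_0 != 0 /\
    (map_poly (evalX kappa w) m).[g] = 0.
  elim/poly_ind: m1 m10 mg1 => [|m c IHm]; first by rewrite eqxx.
  have [->|c0] := eqVneq c 0; last first.
    by move=> _ mg; exists (m * 'X + c%:P); rewrite coefD coefMX coefC add0r.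
  rewrite addr0 mulf_eq0 polyX_eq0 orbF => m0.
  rewrite rmorphM /= map_polyX hornerMX => /eqP; rewrite mulf_eq0 (negPf g0) orbF.
  by move=> /eqP; apply: IHm.
exists m`_0 => // P a XP wa g_0.
have := value_eval2 XP m wa g_0; rewrite mg => /(value_uniq XP (value0 P)).
by rewrite horner_coef0 coef_map /= horner_evalE rootE => <-.
Qed.

(** Up to finitely many points, in homogeneous coordinates: the form in which
    exceptional points occur in the definition of the order sequence. *)
Definition almost_all (Pr : 'rV[L]_n.+1 -> Prop) : Prop :=
  exists bad : seq 'rV[L]_n.+1, forall P, X P ->
    (forall Q, Q \in bad -> ~ same_point P Q) -> Pr P.

Lemma almost_all_true (Pr : 'rV[L]_n.+1 -> Prop) : (forall P, X P -> Pr P) ->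
  almost_all Pr.
Proof. by move=> H; exists [::] => P XP _; apply: H. Qed.

Lemma almost_all_and (Pr1 Pr2 : 'rV[L]_n.+1 -> Prop) :
  almost_all Pr1 -> almost_all Pr2 -> almost_all (fun P => Pr1 P /\ Pr2 P).
Proof.
move=> [b1 H1] [b2 H2]; exists (b1 ++ b2) => P XP HP.
by split; [apply: H1 | apply: H2] => // Q Qb; apply: HP; rewrite mem_cat Qb ?orbT.
Qed.

Lemma almost_all_imp (Pr1 Pr2 : 'rV[L]_n.+1 -> Prop) :
  (forall P, X P -> Pr1 P -> Pr2 P) -> almost_all Pr1 -> almost_all Pr2.
Proof. by move=> H [b H1]; exists b => P XP HP; apply: H => //; apply: H1. Qed.

Lemma almost_all_fin (I : finType) (Pr : I -> 'rV[L]_n.+1 -> Prop) :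
  (forall i, almost_all (Pr i)) -> almost_all (fun P => forall i, Pr i P).
Proof.
move=> /fin_all_exists[b H]; exists (flatten [seq b i | i : I]) => P XP HP i.
apply: H => // Q Qb; apply: HP; apply/flattenP; exists (b i) => //.
by apply/mapP; exists i; rewrite ?mem_enum.
Qed.

(** At the zeros of [f] outside [X_i = 0] each quotient [x_j / x_i] takes finitely
    many values, since [f / x_i ^ d] vanishes there; and one of the [X_i] is not
    zero.  The exceptional points are thus among the finitely many vectors with
    coordinates in a finite set. *)
Lemma homog_neq0_almost_all d f : f \is d.-homog -> mmap kappa x f != 0 ->
  almost_all (fun P => f.@[P ord0] != 0).
Proof.
move=> fd f0.
have [|s sP] := @fin_all_exists (('I_n.+1 * 'I_n.+1)%type) (fun=> seq L) (fun ij s =>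
  forall P, X P ->
    P ord0 ij.1 != 0 -> f.@[P ord0] = 0 -> P ord0 ij.2 / P ord0 ij.1 \in s).
  move=> [i j] /=; have [xi0|xi0] := eqVneq (x i) 0.
    by exists [::] => P XP Pi; have := coord_neq0 XP Pi; rewrite xi0 eqxx.
  have [|s sP] := @finitely_many_values (x j / x i) (mmap kappa x f / x i ^+ d).
    by rewrite mulf_neq0 ?invr_neq0 ?expf_neq0.
  exists s => P XP Pi f_0; apply: (sP P) => //; first exact: value_coord.
  exists d, f, ('X_i ^+ d); rewrite f_0 mul0r; split=> //.
  - by have := dhomogMn d (dhomogX1 L i); rewrite mul1n.
  - by rewrite rmorphXn /= mevalXU expf_neq0.
  - by rewrite rmorphXn /= mmapX mmap1U.
pose S := flatten [seq s ij | ij : 'I_n.+1 * 'I_n.+1].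
exists [seq \row_j nth 0 S (h j) | h : {ffun 'I_n.+1 -> 'I_(size S)}] => P XP HP.
apply/negP => /eqP f_0.
have P0 : exists i, P ord0 i != 0.
  apply/existsP; apply: contraT => /existsPn P0.
  case/negP: (X_neq0 XP); apply/eqP/rowP => j; rewrite mxE; apply/eqP.
  by have := P0 j; rewrite negbK.
have [i Pi] := P0.
have inS j : P ord0 j / P ord0 i \in S.
  apply/flattenP; exists (s (i, j)); last exact: sP.
  by apply/mapP; exists (i, j); rewrite ?mem_enum.
apply: (HP (\row_j (P ord0 j / P ord0 i))).
  apply/mapP; exists [ffun j => Ordinal (etrans (index_mem _ S) (inS j))];
    first by rewrite mem_enum.
  by apply/rowP => j; rewrite !mxE ffunE /= nth_index.
exists (P ord0 i) => //; apply/rowP => j; rewrite !mxE mulrCA mulfV // mulr1 //.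
Qed.

Lemma value_neq0_almost_all y : y != 0 ->
  almost_all (fun P => exists2 c, c != 0 & has_value P y c).
Proof.
case: Kff => _ _ /(_ y)[d [f [g [fd gd g0 ->]]]] f0.
have {}f0 : mmap kappa x f != 0 by apply: contraNneq f0 => ->; rewrite mul0r.
have := almost_all_and (homog_neq0_almost_all fd f0) (homog_neq0_almost_all gd g0).
apply: almost_all_imp => P XP [fP gP].
by exists (f.@[P ord0] / g.@[P ord0]); [rewrite mulf_neq0 ?invr_neq0 | exists d, f, g].
Qed.

Lemma value_almost_all y : almost_all (fun P => exists c, has_value P y c).
Proof.
have [->|/value_neq0_almost_all] := eqVneq y 0.
  by apply: almost_all_true => P XP; exists 0; apply: value0.
by apply: almost_all_imp => P XP [c _ yc]; exists c.
Qed.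

End Values.

(** * Equations of the curve and separating elements *)

Section Homogenize.
Variables (L : fieldType) (n : nat).

(** Any degree not less than that of [g] would do; [msize g] is one more. *)
Definition homogenize (g : {mpoly L[n.+1]}) : {mpoly L[n.+1]} :=
  \sum_(m <- msupp g) g@_m *: ('X_[m] * 'X_ord0 ^+ (msize g - mdeg m)).

Lemma homogenize_homog g : homogenize g \is (msize g).-homog.
Proof.
rewrite /homogenize big_seq; apply: rpred_sum => m mg; apply: dhomogZ.
have h1 : ('X_[m] : {mpoly L[n.+1]}) \is (mdeg m).-homog by rewrite dhomogX.
have h2 := dhomogMn (msize g - mdeg m) (dhomogX1 L (ord0 : 'I_n.+1)).
have := dhomogM h1 h2; rewrite mul1n subnKC //.
by apply: ltnW; apply: msize_mdeg_lt.
Qed.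

Lemma mmap_homogenize (k : fieldType) (lam : {rmorphism L -> k}) (v : 'I_n.+1 -> k) g :
  v ord0 != 0 ->
  mmap lam v (homogenize g) = v ord0 ^+ msize g * mmap lam (fun i => v i / v ord0) g.
Proof.
move=> v0; rewrite /homogenize raddf_sum [in RHS]/mmap mulr_sumr big_seq [RHS]big_seq.
apply: eq_bigr => m mg; rewrite /= mmapZ rmorphM rmorphXn /= !mmapX mmap1U.
rewrite [RHS]mulrCA; congr (_ * _); rewrite /mmap1.
under [in RHS]eq_bigr do rewrite expr_div_n.
rewrite prodf_div prodrXr -mdegE mulrCA; congr (_ * _).
by rewrite expfB_cond ?(negPf v0) //= ltnW // msize_mdeg_lt.
Qed.

End Homogenize.

Lemma map_mxS (R S : comNzRingType) (g : {rmorphism R -> S}) p n r s (Y : nat -> R) :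
  map_mx g (mxS p n r s Y) = mxS p n r s (g \o Y).
Proof.
apply/matrixP => i j; rewrite !mxE.
have gF : g (polF p n r Y) = polF p n r (g \o Y).
  by rewrite rmorph_sum; apply: eq_bigr => k _; rewrite rmorphM !rmorphXn.
by repeat case: ifP => _; rewrite ?rmorph0 ?rmorph1 // rmorphXn // gF.
Qed.

(** The homogenized determinant is a form that vanishes on [S_n], hence on its
    projective closure and on [X]. *)
Lemma det_mxS_coordinates (L : fieldType) p n r s (X : pset L n) (K : fieldType)
    (kappa : {rmorphism L -> K}) (x : 'I_n.+1 -> K) :
  function_field X kappa x -> psubset X (pclosure (@hypersurfaceS p n r s L)) ->
  \det (mxS p n r s (fun i => x (inord i))) = 0.
Proof.
move=> Kff XS; have [x0 van _] := Kff.
pose g : {mpoly L[n.+1]} := \det (mxS p n r s (fun i => 'X_(inord i))).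
have gE (k : fieldType) (lam : {rmorphism L -> k}) v :
    mmap lam v g = \det (mxS p n r s (fun i => v (inord i))).
  rewrite -det_map_mx map_mxS; congr (\det (mxS _ _ _ _ _)).
  by apply: functional_extensionality_dep => i; rewrite /= mmapX mmap1U.
have : mmap kappa x (homogenize g) = 0.
  apply/(van _ (dhomog_homogeneous (homogenize_homog g))) => P /XS[_]; apply.
  split; first exact: dhomog_homogeneous (homogenize_homog g).
  move=> Q [Q0 detQ]; rewrite /meval mmap_homogenize // gE.
  by rewrite detQ mulr0.
rewrite mmap_homogenize ?x0 ?oner_eq0 // expr1n mul1r gE => <-.
by congr (\det (mxS _ _ _ _ _)); apply: functional_extensionality_dep => i; rewrite divr1.
Qed.

Section Separating.
Variables (L : closedFieldType) (n q : nat) (X : pset L n) (K : fieldType).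
Variables (kappa : {rmorphism L -> K}) (x : 'I_n.+1 -> K) (z : K).
Hypothesis Kff : function_field X kappa x.
Hypothesis zsep : separating q kappa x z.

Lemma coord_in_function_field i : in_function_field_over q kappa x (x i).
Proof.
have [x0 _ _] := Kff.
have XF j : 'X_j \is a mpolyOver n.+1 (subFq (L := L) q).
  by rewrite qualifE /= msuppX /= mcoeffX eqxx andbT unfold_in /subFq expr1n eqxx.
exists 1%N, 'X_i, 'X_ord0; rewrite !dhomogX1 !mmapX !mmap1U x0 divr1 oner_eq0.
by split.
Qed.

Lemma separating_transcendental a : evalX kappa z a = 0 -> a = 0.
Proof.
have [_ ntr _ _] := zsep => az; apply: contra_notP ntr => /eqP a0.
by exists a => //; apply/eqP.
Qed.

Lemma in_simple_extension_field y :
  in_simple_extension q kappa z y -> y \in simple_field kappa z.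
Proof.
by case=> a [b [_ _ b0 ->]]; apply/simple_fieldP; exists b => //; exists a.
Qed.

(** Clearing denominators multiplies the separable equation of [x_i] over the
    field generated by [z] by a nonzero constant, so [x_i] remains a simple
    root. *)
Lemma separable_relation i : exists2 m : {poly {poly L}},
  (map_poly (evalX kappa z) m).[x i] = 0 &
  (map_poly (evalX kappa z) m)^`().[x i] != 0.
Proof.
have [_ _ _ /(_ _ (coord_in_function_field i)) [f [fS f_sep fx]]] := zsep.
have [|m [c [c0 mE]]] := @clear_denominators _ _ kappa z f.
  by move=> k; apply/in_simple_extension_field/fS.
exists m; rewrite mE ?derivZ hornerZ ?(rootP fx) ?mulr0 // mulf_neq0 //.
by apply: (coprimep_root _ fx); move: f_sep; rewrite unlock.
Qed.

Lemma algebraic_generated w : (forall i, algebraicOver (simple_emb kappa w) (x i)) ->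
  forall y, algebraicOver (simple_emb kappa w) y.
Proof.
move=> xw y; have [_ _ /(_ y)[d [f [g [_ _ _ ->]]]]] := Kff.
have al (h : {mpoly L[n.+1]}) : algebraicOver (simple_emb kappa w) (mmap kappa x h).
  apply: (big_ind (algebraicOver (simple_emb kappa w))) => [|u v|m _].
  - exact: algebraic0.
  - exact: algebraic_add.
  apply: algebraic_mul.
    by apply: algebraic_simple; rewrite -(evalXC kappa w) evalX_in.
  apply: (big_ind (algebraicOver (simple_emb kappa w))) => [|u v|j _].
  - exact: algebraic1.
  - exact: algebraic_mul.
  elim: (m j) => [|e IHe]; first by rewrite expr0; apply: algebraic1.
  by rewrite exprS; apply: algebraic_mul.
exact: algebraic_div.
Qed.

Lemma coord_algebraic w i : algebraicOver (simple_emb kappa w) z ->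
  algebraicOver (simple_emb kappa w) (x i).
Proof.
move=> zw; have [_ _ _ /(_ _ (coord_in_function_field i)) [f [fS f_sep fx]]] := zsep.
apply: (algebraic_trans zw _ (separable_poly_neq0 f_sep) fx) => k.
exact/in_simple_extension_field/fS.
Qed.

(** The coordinates are algebraic over [L(z)], so [w] is, and by exchange [z] is
    algebraic over [L(w)]; then so are the coordinates and all functions. *)
Lemma function_field_algebraic w y : (forall a, evalX kappa w a = 0 -> a = 0) ->
  algebraicOver (simple_emb kappa w) y.
Proof.
move=> w_tr; apply: algebraic_generated => i; apply: coord_algebraic.
apply: (algebraic_exchange w_tr); apply: algebraic_generated => j.
apply: coord_algebraic; apply: algebraic_simple.
by rewrite -{1}(evalXX kappa z) evalX_in.
Qed.

Lemma separating_exp_inj : injective (fun a => z ^+ a).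
Proof.
move=> a b /= zab; have : evalX kappa z ('X^a - 'X^b) = 0.
  by rewrite rmorphB !rmorphXn /= evalXX zab subrr.
move/separating_transcendental/eqP; rewrite subr_eq0 => /eqP ab.
by have := congr1 (fun h : {poly L} => size h) ab; rewrite !size_polyXn => -[].
Qed.

End Separating.

(** * Intersection multiplicities at a nonsingular point *)

Section LocalRing.
Variables (L : closedFieldType) (n : nat) (X : pset L n) (K : fieldType).
Variables (kappa : {rmorphism L -> K}) (x : 'I_n.+1 -> K).
Hypothesis Kff : function_field X kappa x.
Variables (P : 'rV[L]_n.+1) (XP : X P).
Local Notation val := (has_value kappa x P).

Lemma local_parameter_value t : local_parameter kappa x P t -> val t 0.
Proof. by case=> /in_maximal_idealP. Qed.

Lemma local_parameter_div t y : local_parameter kappa x P t -> val y 0 ->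
  exists2 v, (exists e, val v e) & y = t * v.
Proof.
case=> _ H /in_maximal_idealP/H[v /in_local_ringP vl ->].
by exists v; rewrite // mulrC.
Qed.

Lemma value_neq0 y c : val y c -> c != 0 -> y != 0.
Proof.
move=> yc; apply: contraNneq => y0; move: yc; rewrite y0 => /(value_uniq Kff XP) E.
by rewrite (E _ (value0 kappa x P)).
Qed.

(** Two local parameters differ by a function with a nonzero value, so both sides
    may be compared as powers of [t]. *)
Lemma order_uniq t t' m k u u' c c' : t != 0 ->
  local_parameter kappa x P t -> local_parameter kappa x P t' ->
  val u c -> c != 0 -> val u' c' -> c' != 0 -> t ^+ m * u = t' ^+ k * u' -> m = k.
Proof.
move=> t0 lt lt' uc c0 uc' c0'.
have [v [e ve] t'E] := local_parameter_div lt (local_parameter_value lt').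
have [v' [e' ve'] tE] := local_parameter_div lt' (local_parameter_value lt).
have e0 : e != 0.
  have vv1 : v * v' = 1.
    by apply: (mulfI t0); rewrite mulrA -t'E -tE mulr1.
  have := value_mul ve ve'; rewrite vv1 => /(value_uniq Kff XP (value1 kappa x P)).
  by move=> E; apply: contra_eq_neq E => ->; rewrite mul0r oner_eq0.
rewrite t'E exprMn -mulrA.
have uc1 := value_mul (value_exp k ve) uc'.
have c01 : e ^+ k * c' != 0 by rewrite mulf_neq0 ?expf_neq0.
have main a b w w' d d' : val w d -> d != 0 -> val w' d' ->
    t ^+ a * w = t ^+ b * w' -> (b <= a)%N.
  move=> wd d0 wd' E; rewrite leqNgt; apply/negP => ab.
  move: E; rewrite -(subnKC (ltnW ab)) exprD -mulrA => /(mulfI (expf_neq0 _ t0)) wE.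
  have := value_mul (value_exp (b - a) (local_parameter_value lt)) wd'.
  rewrite -wE expr0n -(subnSK ab) /= mul0r => /(value_uniq Kff XP wd) d_0.
  by rewrite d_0 eqxx in d0.
by move=> E; apply/eqP; rewrite eqn_leq (main _ _ _ _ _ _ uc1 c01 uc (esym E))
  (main _ _ _ _ _ _ uc c0 uc1 E).
Qed.

(** The linear form with coefficients [a], restricted to the affine chart. *)
Definition form_value (a : 'rV[L]_n.+1) : K := \sum_i kappa (a ord0 i) * x i.

Lemma form_value_sum (I : finType) (lambda : I -> L) (B : I -> 'rV[L]_n.+1) :
  form_value (\sum_i lambda i *: B i) = \sum_i kappa (lambda i) * form_value (B i).
Proof.
under [RHS]eq_bigr do rewrite mulr_sumr.
rewrite exchange_big; apply: eq_bigr => j _ /=.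
rewrite summxE rmorph_sum mulr_suml; apply: eq_bigr => i _.
by rewrite mxE rmorphM mulrA.
Qed.

(** The expansion [y = c + e t + ...] of [y] to first order at [P]. *)
Definition jet t y (c e : L) : Prop := exists2 v, val v e & y = kappa c + t * v.

Lemma jet_value t y c e : val t 0 -> jet t y c e -> val y c.
Proof.
move=> t_0 [v ve ->].
have := value_add Kff XP (value_const kappa x P c) (value_mul t_0 ve).
by rewrite mul0r addr0.
Qed.

Lemma jet_dual_values t : t != 0 -> val t 0 ->
  dual_values kappa (idfun : {rmorphism L -> L}) (jet t).
Proof.
move=> t0 t_0; split.
- by move=> c; exists 0; rewrite ?mulr0 ?addr0 //; apply: value0.
- move=> y c e y' c' e' [v ve ->] [v' ve' ->]; exists (v + v').
    exact: (value_add Kff XP).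
  by rewrite rmorphD mulrDr addrACA.
- move=> y c e y' c' e' [v ve ->] [v' ve' ->].
  exists (kappa c * v' + v * kappa c' + t * v * v').
    have h1 := value_mul (value_const kappa x P c) ve'.
    have h2 := value_mul ve (value_const kappa x P c').
    have h3 := value_mul (value_mul t_0 ve) ve'.
    have := value_add Kff XP (value_add Kff XP h1 h2) h3.
    by rewrite !mul0r addr0.
  by rewrite rmorphM; ring.
- move=> y c e c' e' Jy Jy'.
  have cc' := value_uniq Kff XP (jet_value t_0 Jy) (jet_value t_0 Jy').
  case: Jy => v ve -> in Jy' *; case: Jy' => v' ve'; rewrite cc' => /addrI/(mulfI t0) vv'.
  by split=> //; apply: (value_uniq Kff XP ve); rewrite vv'.
Qed.

Lemma jet_exists t y c : local_parameter kappa x P t -> val y c -> exists e, jet t y c e.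
Proof.
move=> lt yc; have := value_add Kff XP yc (value_opp (value_const kappa x P c)).
rewrite subrr => /(local_parameter_div lt)[v [e ve] E]; exists e, v => //.
by rewrite -E addrC subrK.
Qed.

Section Orders.
Variables (t : K) (t0 : t != 0) (lt : local_parameter kappa x P t).
Hypothesis P0 : P ord0 ord0 != 0.
Variables (E : 'I_n.+1 -> nat) (E_inj : injective E).
Variables (B : 'I_n.+1 -> 'rV[L]_n.+1) (u : 'I_n.+1 -> K) (c : 'I_n.+1 -> L).
Hypothesis uc : forall i, val (u i) (c i).
Hypothesis c0 : forall i, c i != 0.
Hypothesis BE : forall i, form_value (B i) = t ^+ E i * u i.

(** The term of least order among those with a nonzero coefficient dominates, as
    the orders are distinct. *)
Lemma order_of_combination (lambda : 'I_n.+1 -> L) :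
  (exists i, lambda i != 0) ->
  exists i u' c', [/\ val u' c', c' != 0 &
    \sum_i kappa (lambda i) * form_value (B i) = t ^+ E i * u'].
Proof.
case=> i1 li1; case: (arg_minnP (P := fun i => lambda i != 0) E li1) => i0 li0 i0min.
exists i0, (\sum_i kappa (lambda i) * t ^+ (E i - E i0) * u i), (lambda i0 * c i0).
split; [|by rewrite mulf_neq0|]; last first.
  rewrite mulr_sumr; apply: eq_bigr => i _; rewrite BE.
  have [->|li] := eqVneq (lambda i) 0; first by rewrite rmorph0 !mul0r mulr0.
  by rewrite -{1}(subnKC (i0min i li)) exprD !mulrA [_ * t ^+ E i0]mulrC.
have -> : lambda i0 * c i0 = \sum_i lambda i * (0 ^+ (E i - E i0)) * c i.
  rewrite (bigD1 i0) //= subnn expr0 mulr1 big1 ?addr0 // => i ii0.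
  have [->|li] := eqVneq (lambda i) 0; first by rewrite !mul0r.
  rewrite expr0n subn_eq0 leqNgt ltn_neqAle (i0min i li).
  by rewrite (inj_eq E_inj) eq_sym ii0 mulr0 mul0r.
apply: (value_sum Kff XP) => i _; apply: value_mul => //.
apply: value_mul; first exact: value_const.
by apply: value_exp; apply: local_parameter_value.
Qed.

(** A vanishing combination would have an order by [order_of_combination], so the
    [n + 1] forms are independent. *)
Lemma forms_basis (a : 'rV[L]_n.+1) : exists lambda : 'I_n.+1 -> L,
  a = \sum_i lambda i *: B i.
Proof.
pose M := \matrix_i B i.
have Mfree : M \in unitmx.
  rewrite -row_free_unit -kermx_eq0; apply/eqP/row_matrixP => i.
  rewrite row0; apply/eqP; apply: contraT => v0.
  set v := row i _ in v0.
  have vM : v *m M = 0 by rewrite /v -row_mul mulmx_ker row0.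
  clearbody v.
  have [|i0 [u' [c' [uc' c0' H]]]] := @order_of_combination (fun i => v ord0 i).
    apply/existsP; apply: contraNT v0 => /existsPn v0.
    apply/eqP/rowP => j; rewrite [RHS]mxE; apply/eqP.
    by have := v0 j; rewrite negbK ord1.
  move: H; rewrite -form_value_sum (_ : \sum_i _ = v *m M); last first.
    by rewrite mulmx_sum_row; apply: eq_bigr => j _; rewrite rowK.
  rewrite vM /form_value big1; last by move=> j _; rewrite mxE rmorph0 mul0r.
  move/esym/eqP; rewrite mulf_eq0 expf_eq0 (negPf t0) andbF /=.
  by rewrite (negPf (value_neq0 uc' c0')).
exists (fun i => (a *m invmx M) ord0 i).
rewrite -[LHS](mulmxKV Mfree) mulmx_sum_row; apply: eq_bigr => j _.
by rewrite rowK.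
Qed.

(** Any form is a combination of the forms [B i], whose order is one of the
    [E i]. *)
Lemma hyperplane_ordersP k : (exists i, E i = k) <->
  exists2 a : 'rV[L]_n.+1, a != 0 & hyperplane_multiplicity kappa x P a k.
Proof.
have [x0 _ _] := Kff.
split=> [[i <-]|[a a0 [b [t' [u' [bP lt' /in_local_ringP[c' uc'] um' H]]]]]].
  exists (B i).
    apply: contraTneq (mulf_neq0 (expf_neq0 (E i) t0) (value_neq0 (uc i) (c0 i))) => B0.
    rewrite -BE B0 negbK /form_value big1 // => j _; by rewrite mxE rmorph0 mul0r.
  exists (delta_mx ord0 ord0), t, (u i); split=> //.
  - rewrite (bigD1 ord0) //= big1 ?addr0 ?mxE ?eqxx ?mul1r // => j /negPf j0.
    by rewrite mxE j0 andbF mul0r.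
  - by apply/in_local_ringP; exists (c i).
  - by move=> /in_maximal_idealP/(value_uniq Kff XP (uc i)) ci; have := c0 i;
      rewrite ci eqxx.
  rewrite -/(form_value (B i)) BE (_ : \sum_(_ < _) _ = 1) ?divr1 //.
  rewrite (bigD1 ord0) //= big1 ?addr0 ?mxE ?eqxx ?rmorph1 ?mul1r // => j /negPf j0.
  by rewrite mxE j0 andbF rmorph0 mul0r.
have c0' : c' != 0.
  by apply: contra_notN um' => /eqP cc; apply/in_maximal_idealP; rewrite -cc.
pose bv := \sum_i b ord0 i * (P ord0 i / P ord0 ord0).
have bv0 : bv != 0.
  rewrite /bv; under eq_bigr do rewrite mulrA.
  by rewrite -mulr_suml mulf_neq0 ?invr_neq0.
have lb : val (form_value b) bv.
  apply: (value_sum Kff XP) => i _; apply: value_mul; first exact: value_const.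
  by have := value_coord kappa x i P0; rewrite x0 divr1.
have {H} aE : form_value a = t' ^+ k * (u' * form_value b).
  by rewrite mulrA -H divfK // (value_neq0 lb).
have [lambda aL] := forms_basis a.
have [|i [u2 [c2 [uc2 c02 HE]]]] := @order_of_combination lambda.
  apply/existsP; apply: contraNT a0 => /existsPn l0; rewrite aL big1 // => i _.
  by have := l0 i; rewrite negbK => /eqP->; rewrite scale0r.
exists i; move: HE; rewrite -form_value_sum -aL aE => HE.
exact: (order_uniq t0 lt lt' uc2 c02 (value_mul uc' lb) (mulf_neq0 c0' bv0) (esym HE)).
Qed.

End Orders.
End LocalRing.

(** * The order sequence *)

Definition orders (p n : nat) (s : nat -> nat) : seq nat :=
  [:: 0%N, 1%N & [seq (p ^ s i)%N | i <- iota 1 n.-1]].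

Lemma nth_orders p n s i : (0 < i < n)%N -> nth 0%N (orders p n s) i.+1 = (p ^ s i)%N.
Proof.
case: i => // i /andP[_ iN]; rewrite /= (nth_map 0%N) ?size_iota; last by lia.
by rewrite nth_iota ?add1n //; lia.
Qed.

Section Orders.
Variables (p n : nat) (s : nat -> nat).
Hypotheses (p_gt1 : (1 < p)%N) (n_gt0 : (0 < n)%N).
Hypothesis s_gt0 : forall i, (0 < i < n)%N -> (0 < s i)%N.
Hypothesis s_incr : forall i j, (0 < i)%N -> (i < j)%N -> (j < n)%N -> (s i < s j)%N.

Lemma size_orders : size (orders p n s) = n.+1.
Proof. by rewrite /= size_map size_iota prednK. Qed.

Lemma orders_sorted : sorted ltn (orders p n s).
Proof.
apply/(sortedP 0%N) => -[|[|i]]; rewrite size_orders => iN //.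
  rewrite (@nth_orders _ _ _ 1); last by lia.
  change (p ^ 0 < p ^ s 1)%N.
  by rewrite ltn_exp2l //; apply: s_gt0; lia.
rewrite (@nth_orders _ _ _ i.+1) ?(@nth_orders _ _ _ i.+2); try by lia.
by change (p ^ s i.+1 < p ^ s i.+2)%N; rewrite ltn_exp2l //; apply: s_incr => //; lia.
Qed.

Lemma orders_ltn i j : (i < j < n.+1)%N ->
  (nth 0 (orders p n s) i < nth 0 (orders p n s) j)%N.
Proof.
move=> /andP[ij jn]; apply: (sorted_ltn_nth ltn_trans 0%N orders_sorted) => //.
  by rewrite inE size_orders (ltn_trans ij).
by rewrite inE size_orders.
Qed.

Lemma orders_leq i j : (i <= j < n.+1)%N ->
  (nth 0 (orders p n s) i <= nth 0 (orders p n s) j)%N.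
Proof.
case/andP; rewrite leq_eqVlt => /orP[/eqP-> //|ij jn].
by apply/ltnW/orders_ltn; rewrite ij.
Qed.

Lemma orders_inj : injective (fun i : 'I_n.+1 => nth 0%N (orders p n s) i).
Proof.
move=> i j /eqP; rewrite nth_uniq ?size_orders ?ltn_ord // => [/eqP/val_inj //|].
by apply: (sorted_uniq ltn_trans ltnn orders_sorted).
Qed.

Lemma mem_orders k :
  (k \in orders p n s) <-> exists i : 'I_n.+1, nth 0%N (orders p n s) i = k.
Proof.
split=> [/(nthP 0%N)[i]|[i <-]]; last by rewrite mem_nth // size_orders.
by rewrite size_orders => iN <-; exists (Ordinal iN).
Qed.

End Orders.

Section OrderSequence.
Variables (L : closedFieldType) (p q n r : nat) (s : nat -> nat) (X : pset L n).
Variables (K : fieldType) (kappa : {rmorphism L -> K}) (x : 'I_n.+1 -> K).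
Hypotheses (charL : p \in [pchar L]) (n_ge2 : (2 <= n)%N) (n_lt_p : (n < p)%N).
Hypothesis r_gt0 : (0 < r)%N.
Hypothesis s_gt0 : forall i, (0 < i < n)%N -> (0 < s i)%N.
Hypothesis s_incr : forall i j, (0 < i)%N -> (i < j)%N -> (j < n)%N -> (s i < s j)%N.
Hypothesis Kff : function_field X kappa x.
Hypothesis X_neq0 : forall P, X P -> P != 0.
Local Notation z := (x (inord 1)).
Hypothesis zsep : separating q kappa x z.
Hypothesis detS : \det (mxS p n r s (fun i => x (inord i))) = 0.

Let p_gt1 : (1 < p)%N. Proof. exact: prime_gt1 (pcharf_prime charL). Qed.
Let charK : p \in [pchar K]. Proof. by rewrite (fmorph_pchar kappa). Qed.

(** Up to sign, the value of this function at [P] is the coefficient of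
    [(z - z(P)) ^ (p ^ s_i)] in the equation of the hyperplane
    [sum_j gamma_j(P) ^ (p ^ s_i) X_j = 0]. *)
Definition contact_coef i := \sum_j dgamma p r x j ^+ (p ^ s i) * x j.

Section AtGoodPoint.
Variables (P : 'rV[L]_n.+1) (XP : X P) (t : K).
Local Notation val := (has_value kappa x P).
Hypothesis lt : local_parameter kappa x P t.
Hypothesis P0 : P ord0 ord0 != 0.
Variable m : 'I_n.+1 -> {poly {poly L}}.
Hypothesis mx : forall i, (map_poly (evalX kappa z) (m i)).[x i] = 0.
Hypothesis mx' : forall i, exists2 c, c != 0 & val (map_poly (evalX kappa z) (m
  i))^`().[x i] c.
Hypothesis z_sep_values : forall i j, (0 < i < n)%N -> (0 < j < n)%N -> i != j ->
  exists2 c, c != 0 & val (z ^+ (p ^ s i) - z ^+ (p ^ s j)) c.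
Hypothesis zNp_value : (forall w, z != w ^+ p) \/ exists w c, z = w ^+ p /\ val w c.
Hypothesis contact_value : forall i, (0 < i < n)%N -> contact_coef i != 0 ->
  exists2 c, c != 0 & val (contact_coef i) c.

Let a (j : 'I_n.+1) : L := P ord0 j / P ord0 ord0.

Let x0 : x ord0 = 1. Proof. by case: Kff. Qed.

Let xa j : val (x j) (a j).
Proof. by have := value_coord kappa x j P0; rewrite x0 divr1. Qed.

Lemma z_nonconstant c : z != kappa c.
Proof.
apply/eqP => zc; have := @separating_transcendental _ _ _ _ _ _ _ zsep ('X - c%:P).
rewrite rmorphB /= evalXX evalXC zc subrr => /(_ erefl)/eqP.
by rewrite polyXsubC_eq0.
Qed.

Lemma local_parameter_neq0 : t != 0.
Proof.
apply/eqP => t0; have [e [v _ zE]] := jet_exists Kff XP lt (xa (inord 1)).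
by case/eqP: (z_nonconstant (a (inord 1))); rewrite zE t0 mul0r addr0.
Qed.

Let t_0 : val t 0. Proof. exact: local_parameter_value lt. Qed.
Let dvJ := jet_dual_values Kff XP local_parameter_neq0 t_0.

(** If the derivative of [z] vanished at [P], the separable relations would make
    the derivatives of all coordinates vanish, hence those of all functions,
    including the local parameter [t]. *)
Lemma coordinate_jets : exists2 d : 'I_n.+1 -> L,
  forall j, jet kappa x P t (x j) (a j) (d j) & d (inord 1) != 0.
Proof.
have [d Jx] := fin_all_exists (fun j => jet_exists Kff XP lt (xa j)).
exists d => //; apply/eqP => d1.
have d0 j : d j = 0.
  have Jz : jet kappa x P t z (a (inord 1)) 0 by rewrite -d1.
  apply: (dv_algebraic dvJ Jz (Jx j) (mx j)).
  have [c c0 vc] := mx' j; apply: contra_neq c0 => m0.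
  rewrite deriv_map in vc; apply: (value_uniq Kff XP vc).
  have := value_eval2 Kff XP (m j)^`() (xa (inord 1)) (xa j).
  rewrite -m0 deriv_map.
  rewrite (_ : map_poly (horner_eval _) _ = map_poly (evalX idfun (a (inord 1))) (m
    j)^`()) //.
  by apply: eq_map_poly => h; rewrite /evalX map_poly_id // horner_evalE.
have Jx0 j : jet kappa x P t (x j) (a j) 0 by rewrite -(d0 j).
have Jpol (f : {mpoly L[n.+1]}) : jet kappa x P t (mmap kappa x f) f.@[a] 0.
  exact: (dv_mpoly0 dvJ).
have [] := lt; case=> e [f [g [fe ge f0 g0 tE]]] _.
have mg := mmap_neq0 Kff XP ge g0.
have ga0 : g.@[a] != 0.
  have h1 := jet_value Kff XP t_0 (Jpol g).
  have h2 : val (mmap kappa x g) (g.@[P ord0] / P ord0 ord0 ^+ e).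
    exists e, g, ('X_ord0 ^+ e); rewrite !rmorphXn /= mevalXU mmapX mmap1U x0 expr1n
      divr1.
    by split; rewrite ?expf_neq0 //; have := dhomogMn e (dhomogX1 L (ord0 : 'I_n.+1));
      rewrite mul1n.
  by rewrite (value_uniq Kff XP h1 h2) mulf_neq0 ?invr_neq0 ?expf_neq0.
have Jt : jet kappa x P t t 0 1.
  by exists 1; [apply: value1 | rewrite rmorph0 add0r mulr1].
have tgE : t * mmap kappa x g = mmap kappa x f by rewrite {1}tE divfK.
have := dv_mul dvJ Jt (Jpol g).
rewrite tgE => /(dv_uniq dvJ (Jpol f))[_].
by rewrite mul0r add0r mul1r => /esym/eqP; rewrite (negPf ga0).
Qed.

(** The forms are [X_0], then [X_1 - x_1(P) X_0], whose order is one because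
    [d_1] is not zero, then [sum_j gamma_j(P) ^ (p ^ s_i) X_j].  Since
    [gamma_j = gamma_j(P) + t v_j], the relation turns the latter into
    [- t ^ (p ^ s_i) sum_j v_j ^ (p ^ s_i) x_j]. *)
Lemma hyperplane_with_order d : (forall j, jet kappa x P t (x j) (a j) (d j)) ->
  d (inord 1) != 0 ->
  forall i : 'I_n.+1, exists (B : 'rV[L]_n.+1) (u : K) (c : L),
    [/\ val u c, c != 0 & form_value kappa x B = t ^+ nth 0%N (orders p n s) i * u].
Proof.
move=> Jx d1.
have zNp w : z != w ^+ p.
  case: zNp_value => [H|[w1 [c [zw vw]]]]; first exact: H.
  have [e Je] := jet_exists Kff XP lt vw.
  by have := dv_not_pth_power dvJ charL (Jx (inord 1)) d1 Je; rewrite {1}zw eqxx.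
have z_inj := separating_exp_inj zsep.
have rel i := core_relation p_gt1 n_ge2 s_incr z_inj detS charK n_lt_p r_gt0 x0 zNp (i
  := i).
have a_uniq : uniq [seq a (inord 1) ^+ (p ^ s i) | i <- iota 1 n.-1].
  rewrite map_inj_in_uniq ?iota_uniq // => i j; rewrite !mem_iota => hi hj aij.
  apply/eqP; apply: contraT => ij.
  have [||c c0 vc] := z_sep_values _ _ ij; [lia | lia|].
  have := value_add Kff XP (value_exp (p ^ s i) (xa (inord 1)))
    (value_opp (value_exp (p ^ s j) (xa (inord 1)))).
  by rewrite aij subrr => /(value_uniq Kff XP vc) c_0; rewrite c_0 eqxx in c0.
have Jgam := dv_gamma dvJ charL r_gt0 Jx.
case=> -[|[|i]] iN.
- exists (delta_mx ord0 ord0), 1, 1; split; [exact: value1 | exact: oner_neq0 |].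
  rewrite /form_value (bigD1 ord0) //= big1 ?addr0 ?mxE ?eqxx ?rmorph1 ?x0 ?mul1r //.
  by move=> j /negPf j0; rewrite mxE j0 andbF rmorph0 mul0r.
- exists (delta_mx ord0 (inord 1) - a (inord 1) *: delta_mx ord0 ord0).
  case: (Jx (inord 1)) => v vd zE; exists v, (d (inord 1)); split=> //.
  rewrite /= expr1 -[RHS](addKr (kappa (a (inord 1)))) -zE addrC /form_value.
  have i10 : (inord 1 == ord0 :> 'I_n.+1) = false by rewrite -val_eqE /= inordK //; lia.
  rewrite (bigD1 ord0) //= (bigD1 (inord 1)) ?i10 //= big1 ?addr0.
    rewrite !mxE !eqxx /= i10 eq_sym i10 /= mulr0n mulr1 mulr0 oppr0 addr0 add0r.
    by rewrite rmorphN rmorph1 x0 mulr1 mul1r.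
  move=> j /andP[/negPf j0 /negPf j1].
  by rewrite !mxE j0 j1 !andbF mulr0n mulr0 oppr0 addr0 rmorph0 mul0r.
have hi : (0 < i.+1 < n)%N by lia.
have [v vE] := fin_all_exists (fun j => let: ex_intro2 v h1 h2 := Jgam j in ex_intro _
  v (conj h1 h2)).
pose i' := i.+1.
exists (\row_j gamma p r a j ^+ (p ^ s i')), (- \sum_j v j ^+ (p ^ s i') * x j),
  (- \sum_j (dgamma p r a j * d (inord 1)) ^+ (p ^ s i') * a j); split.
- apply: value_opp; apply: (value_sum Kff XP) => j _.
  by apply: value_mul => //; apply: value_exp; case: (vE j).
- rewrite oppr_eq0; under eq_bigr do rewrite exprMn mulrAC.
  rewrite -mulr_suml mulf_neq0 ?expf_neq0 //.
  have G0 := dgamma_relation_neq0 dvJ charL r_gt0 n_ge2 Jx s_gt0 x0 a_uniq d1 rel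
    n_lt_p hi.
  have [c c0 vc] := contact_value hi G0; apply: contraNneq c0 => G_0.
  apply/eqP; apply: (value_uniq Kff XP vc); rewrite -G_0.
  apply: (value_sum Kff XP) => j _; apply: value_mul => //; apply: value_exp.
  by have [e /(jet_value Kff XP t_0)] := dv_dgamma dvJ charL r_gt0 Jx j.
rewrite (nth_orders _ _ hi) mulrN mulr_sumr.
apply/eqP; rewrite -addr_eq0 -big_split /=; apply/eqP.
rewrite -[RHS](rel _ hi); apply: eq_bigr => j _.
rewrite mxE rmorphXn /= mulrA -mulrDl; congr (_ * _).
by case: (vE j) => _ ->; rewrite (exprD_pchar charK) exprMn.
Qed.

End AtGoodPoint.

(** A point is exceptional if it lies on [X_0 = 0], if the derivative of a
    separable relation vanishes or has a pole there, if two of the powers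
    [z ^ (p ^ s_i)] take the same value, if a [p]-th root of [z], should there be
    one, has a pole, or if a nonzero [contact_coef i] vanishes or has a pole.
    When some [contact_coef i] is zero or [z] is a [p]-th power there is nothing
    to exclude for it: the existence of a good nonsingular point would already
    be contradictory. *)
Lemma order_sequence_orders : order_sequence X kappa x (orders p n s).
Proof.
split.
- by rewrite size_orders // ltnW.
- by apply: orders_sorted => //; rewrite ltnW.
have [m mx mx'] := fin_all_exists2 (separable_relation Kff zsep).
have alg w y := @function_field_algebraic _ _ _ _ _ _ _ _ Kff zsep w y.
have nz y (y0 : y != 0) := value_neq0_almost_all Kff X_neq0 alg y0.
have A1 : almost_all X (fun P => P ord0 ord0 != 0).
  have := @homog_neq0_almost_all _ _ _ _ _ _ Kff X_neq0 alg _ _ (dhomogX1 L (ord0 :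
    'I_n.+1)).
  rewrite mmapX mmap1U; case: (Kff) => -> _ _ /(_ (oner_neq0 _)).
  by apply: almost_all_imp => P _; rewrite mevalXU.
have A2 := almost_all_fin (fun i => nz _ (mx' i)).
have z_inj := separating_exp_inj zsep.
have A3 : almost_all X (fun P => forall ij : 'I_n * 'I_n,
    (0 < ij.1)%N -> (0 < ij.2)%N -> ij.1 != ij.2 ->
    exists2 c, c != 0 & has_value kappa x P (z ^+ (p ^ s ij.1) - z ^+ (p ^ s ij.2)) c).
  apply: almost_all_fin => -[i j] /=.
  have [|] := boolP [&& (0 < i)%N, (0 < j)%N & i != j]; last first.
    by move=> H; apply: almost_all_true => P _ i0 j0 ij; rewrite i0 j0 ij in H.
  case/and3P=> i0 j0 ij; have zij : z ^+ (p ^ s i) - z ^+ (p ^ s j) != 0.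
    rewrite subr_eq0; apply: contra ij => /eqP/z_inj/eqP;
      rewrite eqn_exp2l // => /eqP sij.
    by apply/eqP/val_inj/(increasing_inj s_incr) => //; rewrite ?i0 ?j0 ltn_ord.
  by apply: almost_all_imp (nz _ zij).
have A4 : almost_all X (fun P => (forall w, z != w ^+ p) \/
    exists w c, z = w ^+ p /\ has_value kappa x P w c).
  have [[w zw]|H] := EM (exists w, z = w ^+ p).
    apply: almost_all_imp (value_almost_all Kff X_neq0 alg w) => P _ [c wc].
    by right; exists w, c.
  by apply: almost_all_true => P _; left=> w; apply/eqP => zw; apply: H; exists w.
have A5 : almost_all X (fun P => forall i : 'I_n, (0 < i)%N -> contact_coef i != 0 ->
    exists2 c, c != 0 & has_value kappa x P (contact_coef i) c).
  apply: almost_all_fin => i; have [G0|G0] := eqVneq (contact_coef i) 0.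
    by apply: almost_all_true => P _ _; case/eqP.
  by apply: almost_all_imp (nz _ G0) => P _ H _ _.
have [bad H] := almost_all_and A1 (almost_all_and A2 (almost_all_and A3 (almost_all_and
  A4 A5))).
exists bad => P XP [t lt] HP k.
have {H HP} [P0 [G2 [G3 [G4 G5]]]] := H P XP HP.
have [d Jx d1] := coordinate_jets XP lt P0 mx G2.
have G3' i j : (0 < i < n)%N -> (0 < j < n)%N -> i != j ->
  exists2 c, c != 0 & has_value kappa x P (z ^+ (p ^ s i) - z ^+ (p ^ s j)) c.
  move=> /andP[i0 iN] /andP[j0 jN] ij.
  by apply: (G3 (Ordinal iN, Ordinal jN)).
have G5' i : (0 < i < n)%N -> contact_coef i != 0 -> exists2 c, c != 0 & has_value
  kappa x P (contact_coef i) c.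
  by move=> /andP[i0 iN]; apply: (G5 (Ordinal iN)).
have [B BP] := fin_all_exists (hyperplane_with_order XP lt P0 G3' G4 G5' Jx d1).
have [u uP] := fin_all_exists BP; have [c cP] := fin_all_exists uP.
have t0 := local_parameter_neq0 XP lt P0.
apply: iff_trans (mem_orders p s (ltnW n_ge2) k) _.
have E_inj := orders_inj p_gt1 (ltnW n_ge2) s_gt0 s_incr.
have uc i : has_value kappa x P (u i) (c i) by case: (cP i).
have c0 i : c i != 0 by case: (cP i).
have BE i : form_value kappa x (B i) = t ^+ nth 0%N (orders p n s) i * u i by case: (cP
  i).
exact: (hyperplane_ordersP Kff XP t0 lt P0 E_inj uc c0 BE k).
Qed.

End OrderSequence.

(** * Hasse derivatives *)

Section Hasse.
Variables (L K : fieldType) (kappa : {rmorphism L -> K}) (zeta : K).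
Variable D : nat -> K -> K.
Hypothesis hasse : hasse_derivatives kappa zeta D.

Lemma hasse0 f : D 0 f = f. Proof. by case: hasse. Qed.

Lemma hasseD k f g : D k (f + g) = D k f + D k g. Proof. by case: hasse. Qed.

Lemma hasseM k f g : D k (f * g) = \sum_(i < k.+1) D i f * D (k - i) g.
Proof. by case: hasse. Qed.

Lemma hasse_zero k : D k 0 = 0.
Proof. by apply: (addrI (D k 0)); rewrite -hasseD !addr0. Qed.

Lemma hasse_one k : D k 1 = (k == 0)%:R.
Proof.
case: k => [|k]; first by rewrite hasse0.
by case: hasse => _ _ _ /(_ k 1); rewrite rmorph1.
Qed.

Lemma hasse_sum k (I : finType) (F : I -> K) : D k (\sum_i F i) = \sum_i D k (F i).
Proof. apply: (big_morph (D k)) => [f g|]; [exact: hasseD | exact: hasse_zero]. Qed.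

Lemma hasse_dual_values : dual_values kappa kappa (fun y c e => c = y /\ e = D 1 y).
Proof.
split=> [c|y c e y' c' e' [-> ->] [-> ->]|y c e y' c' e' [-> ->] [-> ->]|y c e c' e'
  [-> ->] [-> ->]] //.
- by split=> //; case: hasse => _ _ _ /(_ 0%N c).
- by rewrite hasseD.
- by rewrite hasseM !big_ord_recl big_ord0 /= addr0 !hasse0.
Qed.

(** Truncated at order [N]: the Leibniz rule says that coefficients below [N] are
    multiplicative, and Frobenius powers are easy to compute on a
    polynomial. *)
Definition hasse_series N y : {poly K} := \poly_(k < N) D k y.

Lemma hasse_series_exp N y m k : (k < N)%N -> (hasse_series N y ^+ m)`_k = D k (y ^+ m).
Proof.
elim: m k => [|m IHm] k kN; first by rewrite !expr0 hasse_one coef1.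
rewrite !exprS hasseM coefM; apply: eq_bigr => i _.
have iN : (i < N)%N by apply: leq_ltn_trans kN; rewrite -ltnS.
by rewrite coef_poly iN IHm // (leq_ltn_trans (leq_subr _ _)).
Qed.

Variables (p : nat) (charK : p \in [pchar K]).

Lemma hasse_pexp e y k :
  D k (y ^+ (p ^ e)) = \sum_(i < k.+1) (D i y) ^+ (p ^ e) * (k == i * p ^ e)%N%:R.
Proof.
rewrite -(@hasse_series_exp k.+1) // /hasse_series poly_def.
have charP : p \in [pchar {poly K}] by rewrite pchar_poly.
rewrite (expr_sum_pchar charP) coef_sum; apply: eq_bigr => i _.
by rewrite exprZn -exprM coefZ coefXn.
Qed.

Lemma hasse_pexp_lt e y k : (0 < k < p ^ e)%N -> D k (y ^+ (p ^ e)) = 0.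
Proof.
move=> /andP[k0 ke]; rewrite hasse_pexp big1 // => -[[|i] iK] _ /=.
  by rewrite mul0n gtn_eqF ?mulr0.
by rewrite ltn_eqF ?mulr0 // (leq_trans ke) // leq_pmull.
Qed.

Lemma hasse_pexp_eq e y : D (p ^ e) (y ^+ (p ^ e)) = (D 1 y) ^+ (p ^ e).
Proof.
have pe : (0 < p ^ e)%N by rewrite expn_gt0 prime_gt0 // (pcharf_prime charK).
rewrite hasse_pexp (bigD1 (Ordinal (pe : (1 < (p ^ e).+1)%N))) //=.
rewrite mul1n eqxx mulr1 big1 ?addr0 // => -[i iK]; rewrite -val_eqE /= => i1.
have -> : (p ^ e == i * p ^ e)%N = (i == 1)%N.
  by rewrite -{1}[(p ^ e)%N]mul1n eqn_pmul2r // eq_sym.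
by rewrite (negPf i1) mulr0.
Qed.

Section Relation.
Variables (I : finType) (c x : I -> K) (e : nat).
Hypothesis rel : \sum_j c j ^+ (p ^ e) * x j = 0.

(** The derivatives of positive order below [p ^ e] kill [p ^ e]-th powers, so
    the coefficients of the relation behave as constants. *)
Lemma hasse_relation_lt k : (k < p ^ e)%N -> \sum_j c j ^+ (p ^ e) * D k (x j) = 0.
Proof.
move=> ke; have := congr1 (D k) rel; rewrite hasse_zero hasse_sum => E.
rewrite -[RHS]E; apply: eq_bigr => j _.
rewrite hasseM (bigD1 ord0) //= hasse0 subn0 big1 ?addr0 // => -[i iK].
rewrite -val_eqE /= => i0; rewrite hasse_pexp_lt ?mul0r // lt0n i0.
exact: leq_ltn_trans ke.
Qed.

(** At order [p ^ e] the Leibniz rule has exactly two terms. *)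
Lemma hasse_relation_eq :
  \sum_j c j ^+ (p ^ e) * D (p ^ e) (x j) = - \sum_j (D 1 (c j)) ^+ (p ^ e) * x j.
Proof.
have := congr1 (D (p ^ e)) rel; rewrite hasse_zero hasse_sum => E.
apply/eqP; rewrite -addr_eq0 -big_split /= -[X in _ == X]E.
apply/eqP/eq_bigr => j _; rewrite hasseM big_ord_recr /= subnn hasse0 hasse_pexp_eq.
congr (_ + _).
have pe : (0 < p ^ e)%N by rewrite expn_gt0 prime_gt0 // (pcharf_prime charK).
rewrite (bigD1 (Ordinal pe)) //= hasse0 subn0 big1 ?addr0 // => -[i iK].
by rewrite -val_eqE /= => i0; rewrite hasse_pexp_lt ?mul0r // lt0n i0.
Qed.

End Relation.
End Hasse.

Lemma frobenius_detE n Q (K : fieldType) (x : 'I_n.+1 -> K) D (mu : n.-tuple nat) :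
  frobenius_det Q x D mu =
  \det (\matrix_(i < n.+1, j < n.+1)
          if i == ord0 then x j ^+ Q else D (nth 0%N mu i.-1) (x j)).
Proof.
congr (\det _); apply/matrixP => i j; rewrite !mxE.
case: splitP => k ik; rewrite !mxE -val_eqE /= ik; first by rewrite ord1.
by rewrite add1n /= (tnth_nth 0%N).
Qed.

Lemma card_ord_interval N a b : (a <= b <= N)%N ->
  (b - a <= #|[set i : 'I_N | (a <= i < b)%N]|)%N.
Proof.
move=> /andP[ab bN].
have lt (k : 'I_(b - a)) : (a + k < N)%N by have := ltn_ord k; lia.
pose f k := Ordinal (lt k).
have f_inj : injective f by move=> k l /(congr1 val)/addnI/val_inj.
rewrite -[X in (X <= _)%N]card_ord -(card_codom f_inj).
apply/subset_leq_card/subsetP => _ /codomP[k ->]; rewrite inE /=.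
have := ltn_ord k; lia.
Qed.

Lemma lexi_of_pointwise n (nu mu : n.-tuple nat) :
  (forall i, (i < n)%N -> (nth 0 nu i <= nth 0 mu i)%N) ->
  ((nu : n.-tuplelexi nat) <= (mu : n.-tuplelexi nat))%O.
Proof.
move=> H; suff : ((nu : seqlexi nat) <= (mu : seqlexi nat))%O by [].
have : size nu = size mu by rewrite !size_tuple.
have {H} : forall i, (i < size nu)%N -> (nth 0 nu i <= nth 0 mu i)%N by rewrite
  size_tuple.
elim: (nu : seq nat) (mu : seq nat) => [|a s1 IH] [|b s2] // H [ss].
rewrite Order.SeqLexiOrder.lexi_cons; apply/andP; split; first exact: (H 0%N).
by apply/implyP => _; apply: IH => // i; apply: (H i.+1).
Qed.

(** * The Frobenius order sequence *)

Definition remove_order p n s I : n.-tuple nat :=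
  [tuple nth 0%N (orders p n s) (bump I k) | k < n].

Lemma nth_remove_order p n s I k : (k < n)%N ->
  nth 0%N (remove_order p n s I) k = nth 0%N (orders p n s) (bump I k).
Proof. by move=> kn; rewrite -(tnth_nth 0%N _ (Ordinal kn)) tnth_mktuple. Qed.

Lemma remove_order_sorted p n s I : (1 < p)%N -> (0 < n)%N ->
  (forall i, (0 < i < n)%N -> (0 < s i)%N) ->
  (forall i j, (0 < i)%N -> (i < j)%N -> (j < n)%N -> (s i < s j)%N) ->
  sorted ltn (remove_order p n s I).
Proof.
move=> p_gt1 n_gt0 s_gt0 s_incr; apply/(sortedP 0%N) => k; rewrite size_tuple => kn.
rewrite !nth_remove_order //; last by apply: ltnW.
by apply: (orders_ltn p_gt1 n_gt0 s_gt0 s_incr); rewrite /bump; lia.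
Qed.

Lemma remove_order_last p n s I : (1 < n)%N -> (I < n)%N ->
  last 0%N (remove_order p n s I) = (p ^ s n.-1)%N.
Proof.
move=> n1 In; rewrite -nth_last size_tuple nth_remove_order; last by lia.
have -> : bump I n.-1 = n.-1.+1 by rewrite /bump; lia.
by rewrite nth_orders //; lia.
Qed.

(** The least [I > 0] such that [e] holds on [I, ..., n - 2].  The index [n - 1] is
    left out so that [I < n] holds for every [e]. *)
Definition last_vanishing_start n (e : pred nat) : nat :=
  (find (fun I => all e (index_iota I n.-1)) (iota 1 n.-1)).+1.

Lemma last_vanishing_startP n (e : pred nat) (I := last_vanishing_start n e) :
  (1 < n)%N ->
  [/\ (0 < I < n)%N, forall i, (I <= i < n.-1)%N -> e i & (1 < I)%N -> ~~ e I.-1].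
Proof.
move=> n1; rewrite /I /last_vanishing_start; set Pr := fun _ => all _ _.
have hasPr : has Pr (iota 1 n.-1).
  apply/hasP; exists n.-1; first by rewrite mem_iota; lia.
  by rewrite /Pr /index_iota subnn.
have find_lt : (find Pr (iota 1 n.-1) < n.-1)%N.
  by rewrite -[X in (_ < X)%N](size_iota 1) -has_find.
have nthE k : (k < n.-1)%N -> nth 0%N (iota 1 n.-1) k = k.+1.
  by move=> kn; rewrite nth_iota ?add1n.
have := nth_find 0%N hasPr; rewrite nthE // => /allP all_e.
split=> [|i hi|f0]; first by lia.
  by apply: all_e; rewrite mem_index_iota.
have f_pos : (0 < find Pr (iota 1 n.-1))%N by lia.
have f_pred : ((find Pr (iota 1 n.-1)).-1 < find Pr (iota 1 n.-1))%N by lia.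
have := before_find 0%N f_pred; rewrite nthE; last by lia.
rewrite prednK // => /negbT; apply: contra => ef.
apply/allP => i; rewrite mem_index_iota => hi.
have [->//|fi] := eqVneq i (find Pr (iota 1 n.-1)).
by apply: all_e; rewrite mem_index_iota; lia.
Qed.

Section FrobeniusOrders.
Variables (L : closedFieldType) (p q n r Q j0 : nat) (s : nat -> nat) (X : pset L n).
Variables (K : fieldType) (kappa : {rmorphism L -> K}) (x : 'I_n.+1 -> K).
Hypotheses (charL : p \in [pchar L]) (n_gt2 : (2 < n)%N) (n_lt_p : (n < p)%N).
Hypothesis r_gt0 : (0 < r)%N.
Hypothesis s_gt0 : forall i, (0 < i < n)%N -> (0 < s i)%N.
Hypothesis s_incr : forall i j, (0 < i)%N -> (i < j)%N -> (j < n)%N -> (s i < s j)%N.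
Hypothesis Kff : function_field X kappa x.
Local Notation z := (x (inord 1)).
Hypothesis zsep : separating q kappa x z.
Hypothesis detS : \det (mxS p n r s (fun i => x (inord i))) = 0.
Hypothesis j0_bound : (0 < j0 <= n - 2)%N.
Hypothesis QE : Q = (p ^ (s n.-1 - s j0))%N.

Let n_ge2 : (2 <= n)%N. Proof. exact: ltnW. Qed.
Let n_gt0 : (0 < n)%N. Proof. exact: ltnW. Qed.
Let p_gt1 : (1 < p)%N. Proof. exact: prime_gt1 (pcharf_prime charL). Qed.
Let charK : p \in [pchar K]. Proof. by rewrite (fmorph_pchar kappa). Qed.
Let x0 : x ord0 = 1. Proof. by case: Kff. Qed.

Local Notation eps := (nth 0%N (orders p n s)).

(** The product of the row [x ^ Q] with a vector which annihilates all derivatives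
    of order below [p ^ s_i]. *)
Definition frob_defect i := \sum_j gamma p r x j ^+ (p ^ s i) * x j ^+ Q.

(** The least [I] such that [x ^ Q] lies in the span of the rows [D (eps k) x] with
    [k <= I]: together with [x ^ Q] and the lower orders, the order of index [I]
    brings nothing new. *)
Definition skipped : nat := last_vanishing_start n (fun i => frob_defect i == 0).

Lemma skippedP :
  [/\ (0 < skipped < n)%N,
      forall i, (skipped <= i < n.-1)%N -> frob_defect i = 0 &
      (1 < skipped)%N -> frob_defect skipped.-1 != 0].
Proof.
have [sk van nvan] := last_vanishing_startP (fun i => frob_defect i == 0) n_ge2.
by split=> // i /van/eqP.
Qed.

Definition frob_orders : n.-tuple nat := remove_order p n s skipped.

Section Derivatives.
Variables (zeta : K) (D : nat -> K -> K).
Hypothesis hasse : hasse_derivatives kappa zeta D.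

Let dvJ := hasse_dual_values hasse.
Let Jx j : x j = x j /\ D 1 (x j) = D 1 (x j). Proof. by []. Qed.

(** Otherwise the separable relations would make [D 1] vanish on all coordinates,
    hence on [K]; but [D 1 zeta = 1]. *)
Lemma hasse_base_neq0 : D 1 z != 0.
Proof.
apply/eqP => Dz0.
have Dx j : D 1 (x j) = 0.
  have [m mx mx'] := separable_relation Kff zsep j.
  apply: (dv_algebraic (m := m) (z := z) (y := x j) (a := z) (b := x j) dvJ) => //.
have Dpol f : D 1 (mmap kappa x f) = 0.
  have Jx0 j : x j = x j /\ 0 = D 1 (x j) by rewrite Dx.
  by have [_ <-] := dv_mpoly0 dvJ f Jx0.
have [_ _ /(_ zeta)[d [f [g [_ _ g0 zE]]]]] := Kff.
have : D 1 (zeta * mmap kappa x g) = 0 by rewrite zE divfK.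
rewrite (hasseM hasse) !big_ord_recl big_ord0 /= addr0 Dpol mulr0 add0r (hasse0 hasse).
case: hasse => _ _ _ _ /(_ 0%N) ->; rewrite mul1r => /eqP.
by rewrite (negPf g0).
Qed.

Lemma gamma_relation i : (0 < i < n)%N -> \sum_j gamma p r x j ^+ (p ^ s i) * x j = 0.
Proof.
apply: (core_relation p_gt1 n_ge2 s_incr (separating_exp_inj zsep) detS charK n_lt_p
  r_gt0 x0).
move=> w; apply: (dv_not_pth_power dvJ charK (Jx (inord 1)) hasse_base_neq0 (w := w) (b
  := w) (e' := D 1 w)).
by [].
Qed.

Lemma gamma_rows_lt i k : (0 < i < n)%N -> (k < p ^ s i)%N ->
  \sum_j D k (x j) * gamma p r x j ^+ (p ^ s i) = 0.
Proof.
move=> hi hk; rewrite -[RHS](hasse_relation_lt hasse charK (gamma_relation hi) hk).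
by apply: eq_bigr => j _; rewrite mulrC.
Qed.

(** By [hasse_relation_eq] this is [- (D 1 z) ^ (p ^ s_i)] times the nonzero
    function of [dgamma_relation_neq0]. *)
Lemma gamma_rows_eq i : (0 < i < n)%N ->
  \sum_j D (p ^ s i) (x j) * gamma p r x j ^+ (p ^ s i) != 0.
Proof.
move=> hi; under eq_bigr do rewrite mulrC.
rewrite (hasse_relation_eq hasse charK (gamma_relation hi)) oppr_eq0.
have Dg j : D 1 (gamma p r x j) = dgamma p r x j * D 1 z.
  by have [_ <-] := dv_gamma dvJ charK r_gt0 Jx j.
under eq_bigr do rewrite Dg exprMn mulrAC.
rewrite -mulr_suml mulf_neq0 ?expf_neq0 ?hasse_base_neq0 //.
apply: (dgamma_relation_neq0 dvJ charK r_gt0 n_ge2 Jx s_gt0 x0 _ hasse_base_neq0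
  gamma_relation n_lt_p hi).
have := uniq_powers s_incr 0 p_gt1 (separating_exp_inj zsep).
by congr (is_true (uniq _)); apply: eq_map => l; rewrite addn0.
Qed.

(** The [Q]-th power of the relation of index [j0], because
    [p ^ s_j0 * Q = p ^ s_(n - 1)]. *)
Lemma last_defect : frob_defect n.-1 = 0.
Proof.
have hj : (0 < j0 < n)%N by lia.
have := congr1 (fun y => y ^+ Q) (gamma_relation hj).
rewrite /= QE (expr0_pchar charK) (expr_sum_pchar charK) => E.
rewrite -[RHS]E /frob_defect QE; apply: eq_bigr => j _.
rewrite exprMn -exprM -expnD subnKC //.
by apply/ltnW/s_incr; lia.
Qed.

Lemma skipped_defect i : (skipped <= i < n)%N -> frob_defect i = 0.
Proof.
move=> hi; have [_ H _] := skippedP.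
have [->|ni] := eqVneq i n.-1; first exact: last_defect.
by apply: H; lia.
Qed.

(** The columns are [X_0], [X_1 - z X_0] and the vectors of the relations: they
    are chosen so that the rows [D (eps i) x] become triangular. *)
Definition dual_basis : 'M[K]_n.+1 := \matrix_(j, l)
  if l == ord0 then (j == ord0)%:R
  else if l == 1%N :> nat then (j == inord 1)%:R - z * (j == ord0)%:R
  else gamma p r x j ^+ (p ^ s l.-1).

Lemma row_dual_basis (M : 'M[K]_n.+1) i l : (M *m dual_basis) i l =
  if l == ord0 then M i ord0
  else if l == 1%N :> nat then M i (inord 1) - z * M i ord0
  else \sum_j M i j * gamma p r x j ^+ (p ^ s l.-1).
Proof.
have pick (k : 'I_n.+1) : \sum_j M i j * (j == k)%:R = M i k.
  rewrite (bigD1 k) //= eqxx mulr1 big1 ?addr0 // => j /negPf ->.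
  by rewrite mulr0.
rewrite mxE; have [l0|l0] := eqVneq l ord0.
  by rewrite -[RHS]pick; apply: eq_bigr => j _; rewrite mxE l0 eqxx.
have [l1|l1] := eqVneq (l : nat) 1%N; last first.
  by apply: eq_bigr => j _; rewrite mxE (negPf l0) (negPf l1).
rewrite -[M i (inord 1)]pick -[M i ord0]pick mulr_sumr -sumrB.
apply: eq_bigr => j _; rewrite mxE (negPf l0) l1 eqxx mulrBr.
by congr (_ - _); rewrite mulrCA.
Qed.

(** The rows of the Frobenius determinant, with [x ^ Q] moved to the place of the
    order which is left out. *)
Definition inserted_rows : 'M[K]_n.+1 := \matrix_(i, j)
  if i == skipped :> nat then x j ^+ Q else D (eps i) (x j).

(** The product is lower triangular.  On the row [x ^ Q] the entries to the right
    of the diagonal are the vanishing [frob_defect i], and the diagonal entry is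
    the last nonvanishing one, or [z ^ Q - z] when the order [1] is left out. *)
Lemma det_inserted_rows : \det (inserted_rows *m dual_basis) != 0.
Proof.
have [/andP[sk0 skn] _ skd] := skippedP.
have i1v : (inord 1 : 'I_n.+1) = 1%N :> nat by rewrite inordK.
have trig : is_trig_mx (inserted_rows *m dual_basis).
  apply/is_trig_mxP => i l il; rewrite row_dual_basis -val_eqE /=.
  have -> : (l == 0 :> nat)%N = false by lia.
  have [l1|l1] := eqVneq (l : nat) 1%N.
    have i0 : i = 0%N :> nat by lia.
    have sk0' : (0%N == skipped) = false by lia.
    by rewrite !mxE i0 sk0' !(hasse0 hasse) x0 mulr1 subrr.
  have hl : (0 < l.-1 < n)%N by have := ltn_ord l; lia.
  have [isk|isk] := eqVneq (i : nat) skipped.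
    rewrite -[RHS](@skipped_defect l.-1); last by lia.
    by apply: eq_bigr => j _; rewrite mxE isk eqxx mulrC.
  rewrite -[RHS](@gamma_rows_lt l.-1 (eps i)) //.
    by apply: eq_bigr => j _; rewrite mxE (negPf isk).
  rewrite -(nth_orders p s hl) prednK; last by lia.
  by apply: (orders_ltn p_gt1 n_gt0 s_gt0 s_incr); rewrite il ltn_ord.
rewrite (det_trig trig); apply/prodf_neq0 => i _; rewrite row_dual_basis -val_eqE /=.
have [i0|i0] := eqVneq (i : nat) 0%N.
  by rewrite mxE ifF ?i0 /= ?(hasse0 hasse) ?x0 ?oner_eq0 //; lia.
have [i1|i1] := eqVneq (i : nat) 1%N.
  rewrite !mxE i1; have [sk1|sk1] := eqVneq 1%N skipped.
    rewrite x0 expr1n mulr1 subr_eq0 -[X in _ != X]expr1 (inj_eq (separating_exp_inj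
      zsep)).
    rewrite QE -(expn0 p) eqn_exp2l // subn_eq0 -ltnNge; apply: s_incr; lia.
  by rewrite /= x0 (hasse_one hasse) mulr0 subr0 hasse_base_neq0.
have hi : (0 < i.-1 < n)%N by have := ltn_ord i; lia.
have [isk|isk] := eqVneq (i : nat) skipped.
  have sk1 : (1 < skipped)%N by lia.
  have := skd sk1; rewrite -isk; congr (_ != _).
  by apply: eq_bigr => j _; rewrite mxE isk eqxx mulrC.
have := gamma_rows_eq hi; congr (_ != _).
apply: eq_bigr => j _; rewrite mxE (negPf isk); congr (D _ _ * _).
by rewrite -(nth_orders p s hi) prednK //; lia.
Qed.

Lemma det_dual_basis : \det dual_basis != 0.
Proof. by have := det_inserted_rows; rewrite det_mulmx mulf_eq0 negb_or => /andP[]. Qed.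

Lemma frob_orders_det : frobenius_det Q x D frob_orders != 0.
Proof.
have [/andP[sk0 skn] _ _] := skippedP.
have : inserted_rows \in unitmx.
  by have := det_inserted_rows; rewrite det_mulmx mulf_eq0 negb_or unitmxE unitfE =>
    /andP[].
rewrite frobenius_detE; set M := \matrix_(_, _) _.
rewrite -unitfE -unitmxE -!row_full_unit -!sub1mx => /submx_trans; apply.
apply/row_subP => i.
(* the position of the [i]-th row of [inserted_rows] in the Frobenius
   determinant *)
pose k : nat := if (i : nat) == skipped then 0%N else if (i < skipped)%N then i.+1 else i.
have kn : (k < n.+1)%N by rewrite /k; have := ltn_ord i; do 2 case: ifP => //; lia.
rewrite (_ : row i inserted_rows = row (Ordinal kn) M) ?row_sub //.
apply/rowP => j; rewrite !mxE -[Ordinal kn == ord0]val_eqE /= /k.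
have [isk|isk] := eqVneq (i : nat) skipped => //.
case: ltnP => h; rewrite ?ifF; try lia.
- by rewrite nth_remove_order /bump; [congr (D (eps _) _) |]; lia.
- by rewrite nth_remove_order /bump; [congr (D (eps _) _) |]; have := ltn_ord i; lia.
Qed.

(** If [mu_i] were smaller than the [i]-th Frobenius order, the first [i + 1] rows
    of derivatives, together with [x ^ Q] when [i] is beyond the skipped index,
    would be annihilated by so many columns of [dual_basis] that the determinant
    would vanish. *)
Lemma frob_orders_min (mu : n.-tuple nat) :
  sorted ltn mu -> frobenius_det Q x D mu != 0 ->
  forall i, (i < n)%N -> (nth 0%N frob_orders i <= nth 0%N mu i)%N.
Proof.
move=> mu_sorted; rewrite frobenius_detE; set M := \matrix_(_, _) _ => detM i iN.
rewrite leqNgt; apply/negP => mu_lt.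
have mu_incr k l : (k < l < n)%N -> (nth 0 mu k < nth 0 mu l)%N.
  move=> /andP[kl ln]; apply: (sorted_ltn_nth ltn_trans 0%N mu_sorted) => //.
    by rewrite inE size_tuple (ltn_trans kl).
  by rewrite inE size_tuple.
have mu_leq k : (k <= i)%N -> (nth 0 mu k <= nth 0 mu i)%N.
  by rewrite leq_eqVlt => /orP[/eqP->//|ki]; apply/ltnW/mu_incr; rewrite ki.
case/negP: (mulf_neq0 detM det_dual_basis); rewrite -det_mulmx; apply/eqP.
rewrite nth_remove_order // in mu_lt.
have row_zero (k l : 'I_n.+1) : (0 < k <= i.+1)%N -> (1 < l)%N -> (bump skipped i <=
  l)%N ->
    (M *m dual_basis) k l = 0.
  move=> /andP[k0 ki] l1 il; rewrite row_dual_basis -val_eqE /= !ifF; try lia.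
  have hl : (0 < l.-1 < n)%N by have := ltn_ord l; lia.
  rewrite -[RHS](@gamma_rows_lt l.-1 (nth 0 mu k.-1)) //.
    by apply: eq_bigr => j _; rewrite mxE ifF // -val_eqE /=; lia.
  rewrite -(nth_orders p s hl) prednK; last by lia.
  apply: leq_ltn_trans (mu_leq _ _) _; first by lia.
  by apply: leq_trans mu_lt _; apply: (orders_leq p_gt1 n_gt0 s_gt0 s_incr);
    rewrite il ltn_ord.
have [/andP[sk0 skn] _ _] := skippedP.
have [ik|ik] := ltnP i skipped.
  (* a strictly increasing sequence cannot go below the orders [0] and [1] *)
  have i2 : (1 < i)%N.
    have bi : bump skipped i = i by rewrite /bump; lia.
    move: mu_lt; rewrite bi; case: (i) mu_incr iN => [|[|//]] H H1 //=.
    by have := H 0%N 1%N; rewrite H1 => /(_ isT); lia.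
  apply: (@det_zero_block _ _ _ [set k : 'I_n.+1 | (1 <= k < i.+2)%N] [set l : 'I_n.+1
    | (i <= l < n.+1)%N]).
    move=> k l; rewrite !inE => hk hl; apply: row_zero; try lia.
    by rewrite /bump; lia.
  have c1 := @card_ord_interval n.+1 1 i.+2 ltac:(lia).
  have c2 := @card_ord_interval n.+1 i n.+1 ltac:(lia).
  by apply: leq_trans (leq_add c1 c2); lia.
apply: (@det_zero_block _ _ _ [set k : 'I_n.+1 | (0 <= k < i.+2)%N] [set l : 'I_n.+1 |
  (i.+1 <= l < n.+1)%N]).
  move=> k l; rewrite !inE => hk hl; have [k0|k0] := posnP k; last first.
    by apply: row_zero; rewrite /bump; lia.
  rewrite row_dual_basis -val_eqE /= !ifF; try lia.
  rewrite -[RHS](@skipped_defect l.-1); last by lia.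
  by apply: eq_bigr => j _; rewrite mxE -val_eqE /= k0 eqxx mulrC.
have c1 := @card_ord_interval n.+1 0 i.+2 ltac:(lia).
have c2 := @card_ord_interval n.+1 i.+1 n.+1 ltac:(lia).
by apply: leq_trans (leq_add c1 c2); lia.
Qed.

End Derivatives.

Lemma frobenius_orders_of_curve : frobenius_order_sequence Q kappa x frob_orders.
Proof.
split; first exact: remove_order_sorted.
move=> zeta D _ hasse; split; first exact: frob_orders_det hasse.
by move=> mu mu_sorted mu_det; apply/lexi_of_pointwise/(frob_orders_min hasse).
Qed.

End FrobeniusOrders.

Theorem proposition4p3
    (p q h n r : nat) (s : nat -> nat)
    (p_pr : prime p) (qE : q = (p ^ h)%N)
    (n_ge2 : (2 <= n)%N) (n_lt_p : (n < p)%N)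
    (r_gt0 : (0 < r)%N)
    (s_gt0 : forall i, (1 <= i < n)%N -> (0 < s i)%N)
    (s_incr : forall i j, (1 <= i)%N -> (i < j)%N -> (j < n)%N ->
                (s i < s j)%N)
    (s_pow : forall i, (1 <= i < n)%N ->
               exists m : nat, (p ^ (s i + r))%N = (q ^ m)%N)
    (F : finFieldType) (cardF : #|F| = q)
    (L : closedFieldType) (phi : {rmorphism F -> L})
    (L_closure : integralRange phi)
    (X : pset L n)
    (X_curve : curve_over q X) (X_nondeg : nondegenerate_pset X)
    (K : fieldType) (kappa : {rmorphism L -> K}) (x : 'I_n.+1 -> K)
    (K_funfield : function_field X kappa x)
    (x1_sep : separating q kappa x (x (inord 1)))
    (C : pset L n)
    (C_comp : irreducible_component C (pclosure (@hypersurfaceS p n r s L)))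
    (C_nonlinear : ~ linear_pset C)
    (X_sub_C : psubset X C) :
  order_sequence X kappa x
    [:: 0%N, 1%N & [seq (p ^ s i)%N | i <- iota 1 n.-1]] /\
  ((2 < n)%N -> forall j, (1 <= j <= n - 2)%N ->
     exists2 nu : n.-tuple nat,
       frobenius_order_sequence (p ^ (s n.-1 - s j)) kappa x nu &
       last 0%N nu = (p ^ s n.-1)%N).
Proof.
have charL : p \in [pchar L].
  rewrite (fmorph_pchar phi); apply: (card_finPcharP (n := h)) => //.
  by rewrite cardF.
have X_neq0 P : X P -> P != 0.
  by have [[I _ XI] _ _ _] := X_curve => /XI[].
have detS : \det (mxS p n r s (fun i => x (inord i))) = 0.
  apply: (det_mxS_coordinates K_funfield) => P /X_sub_C.
  by have [_ CS _] := C_comp; apply: CS.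
split; first exact: (order_sequence_orders charL n_ge2 n_lt_p r_gt0 s_gt0 s_incr
    K_funfield X_neq0 x1_sep detS).
move=> n_gt2 j hj; exists (frob_orders p r (p ^ (s n.-1 - s j)) s x).
  exact: (frobenius_orders_of_curve charL n_gt2 n_lt_p r_gt0 s_gt0 s_incr
    K_funfield x1_sep detS hj erefl).
by apply: remove_order_last => //; have [/andP[]] := skippedP p r (p ^ (s n.-1 - s j))
  s x n_gt2.
Qed.
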